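(* Let $H$ and $K$ be subgroups of rank $2$ of a free group $F$. Then $$\operatorname{rank}(H\cap K) \;\leq\; 4 - \operatorname{rank}(H\vee K).$$
   Context: For subgroups $H$ and $K$ of a free group, $H\vee K=\langle H,K\rangle$ denotes their join, i.e. the subgroup generated by $H\cup K$. The rank of a free group is the cardinality of a free basis; the trivial group has rank $0$. *)

(* Defs.v *)
From mathcomp Require Import all_boot all_order all_algebra.
From mathcomp Require Import boolp classical_sets functions cardinality.

Set Implicit Arguments.
Unset Strict Implicit.
Unset Printing Implicit Defensive.

Local Open Scope classical_set_scope.
Local Open Scope group_scope.
Local Open Scope card_scope.

Definition subgroup (F : groupType) (G : set F) : Prop :=
  group_closed (mem G).

Definition generated (F : groupType) (A : set F) : set F :=
  smallest (@subgroup F) A.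

Definition join (F : groupType) (H K : set F) : set F :=
  generated (H `|` K).

(* The letter (x, false) stands for x and (x, true) for the formal inverse of
   x. *)
Definition word (F : groupType) := seq (F * bool).

Definition reduced (F : groupType) (w : word F) : bool :=
  sorted (fun a b : F * bool => ~~ ((a.1 == b.1) && (a.2 != b.2))) w.

Definition word_over (F : groupType) (B : set F) (w : word F) : Prop :=
  forall a, a \in w -> B a.1.

Definition word_value (F : groupType) (w : word F) : F :=
  \prod_(a <- w) (if a.2 then a.1^-1 else a.1).

(* The second clause also forces 1 to be outside B, and forbids B to contain
   both x and its inverse. *)
Definition free_basis (F : groupType) (G B : set F) : Prop :=
  generated B = G /\
  forall w : word F,
    reduced w -> word_over B w -> w <> [::] -> word_value w <> 1.

Definition free_group (F : groupType) : Prop :=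
  exists B : set F, free_basis setT B.

(* Ranks are cardinalities of free bases; has_rank G n also says that G is
   free. *)
Definition has_rank (F : groupType) (G : set F) (n : nat) : Prop :=
  exists B : set F, free_basis G B /\ B #= `I_n.

(* Main.v *)
(* A free group F carries a bi-invariant total order (Magnus), so the
   Malcev-Neumann series on F form a division ring D containing Q[F], and the
   series supported on a subgroup G form a division subring D_G; clearly D_H and
   D_K meet in D_L, where L is the intersection of H and K. Let X be a basis of
   the join J, and send g in J to its gradient (dg/dx)_x in the left D-space D^X,
   where dg/dx are Fox derivatives. The gradients of J span D^X, those of H (resp.
   K) span a space of dimension at most 2, so rank J is at most 4 - d, where d is
   the dimension of the common part. A Schreier basis B of L has gradients that
   are independent over D_L, and any two of them are independent over D. Hence d
   is at least min(|B|, 2). If B had three elements, the third gradient would be a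
   combination of the first two with coefficients in D_H and also in D_K, hence in
   D_L, which is impossible; so |B| <= 2 and rank J <= 4 - |B|. *)
Require Import Defs.
From HB Require Import structures.
From mathcomp Require Import all_boot all_order all_algebra.
From mathcomp Require Import boolp classical_sets functions cardinality.
From mathcomp Require Import fsbigop wochoice.

Set Implicit Arguments.
Unset Strict Implicit.
Unset Printing Implicit Defensive.

Import Order.TTheory GRing.Theory Num.Theory.

Local Open Scope classical_set_scope.
Local Open Scope group_scope.
Local Open Scope card_scope.

(** Series with well-ordered support are chosen because a series supported on H and on K is visibly
    supported on L; the whole bound rests on coefficients known in D_H and in D_K falling into D_L.
    Three gradients of B may well be dependent over D: inside a group of rank 2 all gradients lie in
    a space of dimension 2. Pairs are safe thanks to the fundamental formula of Fox, by which the
    sum of (dg/dx)(x - 1) over x is g - 1. It turns a relation between the gradients of g1 and g2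
    with coefficients c1, c2 into c1(g1 - 1) + c2(g2 - 1) = 0, so the ratio of c1 and c2 lies in
    D_L, over which the gradients are independent. Hence the 2 in min(|B|, 2) and the separate
    exclusion of a third element. Freeness of J and of L is part of the claim. The coefficient
    extraction that gives independence over D_L also proves that the Schreier generators are
    free. *)

Section Subgroups.
Context {F : groupType}.
Implicit Types (G A B : set F) (x y : F).

Lemma subgroup1 G : subgroup G -> G 1.
Proof. by case; rewrite inE. Qed.

Lemma subgroupF G x y : subgroup G -> G x -> G y -> G (x / y).
Proof. by case=> _ h Gx Gy; have := h x y; rewrite !inE; apply. Qed.

Lemma subgroupV G x : subgroup G -> G x -> G x^-1.
Proof. by move=> sG Gx; rewrite -div1g; apply: subgroupF => //; apply: subgroup1. Qed.

Lemma subgroupM G x y : subgroup G -> G x -> G y -> G (x * y).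
Proof. by move=> sG Gx Gy; rewrite -[y]invgK; apply: subgroupF => //; apply: subgroupV. Qed.

Lemma subgroupP G :
  G 1 -> (forall x y, G x -> G y -> G (x * y)) -> (forall x, G x -> G x^-1) ->
  subgroup G.
Proof.
move=> G1 GM GV; split; first by rewrite inE.
by move=> x y; rewrite !inE => Gx Gy; apply: GM => //; apply: GV.
Qed.

Lemma subgroupT : subgroup [set: F].
Proof. exact: subgroupP. Qed.

Lemma subgroupI G G' : subgroup G -> subgroup G' -> subgroup (G `&` G').
Proof.
move=> sG sG'; apply: subgroupP; first by split; apply: subgroup1.
  by move=> x y [Gx G'x] [Gy G'y]; split; apply: subgroupM.
by move=> x [Gx G'x]; split; apply: subgroupV.
Qed.

Lemma generated_subgroup A : subgroup (generated A).
Proof.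
apply: subgroupP.
- by move=> G [sG _]; apply: subgroup1.
- by move=> x y gx gy G sGA; case: (sGA) => sG _; apply: subgroupM; [|apply: gx|apply: gy].
- by move=> x gx G sGA; case: (sGA) => sG _; apply: subgroupV => //; apply: gx.
Qed.

Lemma sub_generated A : A `<=` generated A.
Proof. by move=> x Ax G [_]; apply. Qed.

Lemma generated_sub A G : subgroup G -> A `<=` G -> generated A `<=` G.
Proof. by move=> sG AG x; apply. Qed.

Lemma free_basis_subgroup G B : free_basis G B -> subgroup G.
Proof. by case=> <- _; apply: generated_subgroup. Qed.

Lemma free_basis_sub G B : free_basis G B -> B `<=` G.
Proof. by case=> <- _; apply: sub_generated. Qed.

End Subgroups.

(** * Words and free bases *)

Section Words.
Context {F : groupType}.
Implicit Types (B G : set F) (w u v : word F) (a : F * bool).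

Definition letter a : F := if a.2 then a.1^-1 else a.1.
Definition inv_letter a : F * bool := (a.1, ~~ a.2).
Definition inv_word w : word F := rev (map inv_letter w).

Lemma inv_letterK : involutive inv_letter.
Proof. by case=> x b; rewrite /inv_letter /= negbK. Qed.

Lemma letter_inv a : letter (inv_letter a) = (letter a)^-1.
Proof. by case: a => x []; rewrite /letter /= ?invgK. Qed.

Lemma word_value_nil : word_value [::] = 1 :> F.
Proof. by rewrite /word_value big_nil. Qed.

Lemma word_value_cons a w : word_value (a :: w) = letter a * word_value w.
Proof. by rewrite /word_value big_cons. Qed.

Lemma word_value_cat u v : word_value (u ++ v) = word_value u * word_value v.
Proof. by rewrite /word_value big_cat. Qed.

Lemma word_value_inv w : word_value (inv_word w) = (word_value w)^-1.
Proof.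
elim: w => [|a w IH]; first by rewrite word_value_nil invg1.
rewrite /inv_word /= rev_cons -cats1 word_value_cat -/(inv_word w) IH.
by rewrite !word_value_cons word_value_nil mulg1 letter_inv invgM.
Qed.

Lemma word_over_cons B a w : word_over B (a :: w) <-> B a.1 /\ word_over B w.
Proof.
split=> [h|[h1 h2] c].
  by split=> [|c cw]; apply: h; rewrite inE ?eqxx // cw orbT.
by rewrite inE => /orP[/eqP-> //|/h2].
Qed.

Lemma word_over_cat B u v : word_over B (u ++ v) <-> word_over B u /\ word_over B v.
Proof.
split=> [h|[h1 h2] c].
  by split=> c cw; apply: h; rewrite mem_cat cw ?orbT.
by rewrite mem_cat => /orP[/h1|/h2].
Qed.

Lemma word_over_inv B w : word_over B w -> word_over B (inv_word w).
Proof. by move=> h a; rewrite mem_rev => /mapP[c /h hc ->]. Qed.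

Lemma word_value_in B G w : subgroup G -> B `<=` G -> word_over B w -> G (word_value w).
Proof.
move=> sG BG; elim: w => [|a w IH]; first by rewrite word_value_nil => _; apply: subgroup1.
move=> /word_over_cons[/BG Ga /IH Gw]; rewrite word_value_cons.
by apply: subgroupM => //; rewrite /letter; case: a.2 => //; apply: subgroupV.
Qed.

Lemma generatedE B x : generated B x -> exists2 w, word_over B w & word_value w = x.
Proof.
apply: (@generated_sub _ B [set x | exists2 w, word_over B w & word_value w = x]).
  apply: subgroupP => [|y z|y].
  - by exists [::]; rewrite ?word_value_nil.
  - move=> [w hw <-] [w' hw' <-]; exists (w ++ w'); rewrite ?word_value_cat //.
    exact/word_over_cat.
  - by move=> [w hw <-]; exists (inv_word w); [apply: word_over_inv|rewrite word_value_inv].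
move=> y By; exists [:: (y, false)]; first exact/word_over_cons.
by rewrite word_value_cons word_value_nil mulg1.
Qed.

Definition compatible a c := ~~ ((a.1 == c.1) && (a.2 != c.2)).

Lemma compatibleE a c : compatible a c = (c != inv_letter a).
Proof.
by case: a c => x b [y c]; rewrite /compatible /inv_letter xpair_eqE /= eq_sym; case: b c => [] [].
Qed.

Lemma compatible_inv a c : compatible a c = compatible (inv_letter c) (inv_letter a).
Proof.
by rewrite /compatible /= eq_sym; case: a c => x b [y c] /=; case: b c => [] [].
Qed.

Lemma reducedE w : reduced w = sorted compatible w. Proof. by []. Qed.

Lemma reduced_cat_cons u a v c :
  reduced (rcons u a) -> reduced (c :: v) -> compatible a c -> reduced (rcons u a ++ c :: v).
Proof.
rewrite !reducedE; case: u => [|b u] /=; first by move=> _ -> ->.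
by rewrite cat_path last_rcons /= => -> -> ->.
Qed.

Lemma reduced_inv w : reduced w -> reduced (inv_word w).
Proof.
rewrite !reducedE /inv_word rev_sorted sorted_map; apply: sub_sorted => a c.
by rewrite compatible_inv /= /relpre /=.
Qed.

(** If the first letters differ, the inverse of the first word followed by the second is reduced,
    nonempty and of value 1. *)
Lemma reduced_uniq G B u v : free_basis G B ->
  reduced u -> reduced v -> word_over B u -> word_over B v ->
  word_value u = word_value v -> u = v.
Proof.
move=> [_ fB]; elim: u v => [|a u IH] v ru rv ou ov.
  case: v rv ov => // c v rv ov /esym; rewrite word_value_nil => /fB H.
  by case: (H rv ov).
case: v rv ov => [|c v] rv ov.
  by rewrite word_value_nil => /fB H; case: (H ru ou).
have [<-|ac] := eqVneq a c.
  rewrite !word_value_cons => /mulgI e; congr (_ :: _); apply: IH e => //.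
  - exact: path_sorted ru.
  - exact: path_sorted rv.
  - by case/word_over_cons: ou.
  - by case/word_over_cons: ov.
move=> e; exfalso; apply: (fB (inv_word (a :: u) ++ c :: v)).
- rewrite /inv_word /= rev_cons; apply: reduced_cat_cons => //.
    by rewrite -rev_cons -map_cons; apply: reduced_inv.
  by rewrite compatibleE inv_letterK eq_sym.
- by apply/word_over_cat; split=> //; apply: word_over_inv.
- by rewrite /inv_word /= rev_cons; case: (rev _).
- by rewrite word_value_cat word_value_inv e mulVg.
Qed.

Definition push a w := if w is c :: w' then (if c == inv_letter a then w' else a :: w) else [:: a].

Lemma reduced_push a w : reduced w -> reduced (push a w).
Proof.
case: w => //= c w rw; case: ifP => [_|/negbT h]; first exact: path_sorted rw.
by rewrite reducedE /= compatibleE h.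
Qed.

Definition reduction w := foldr push [::] w.

Lemma reduced_reduction w : reduced (reduction w).
Proof. by elim: w => //= a w; apply: reduced_push. Qed.

Lemma reduction_over B w : word_over B w -> word_over B (reduction w).
Proof.
elim: w => //= a w IH /word_over_cons[Ba /IH]; case: (reduction w) => [_|c w'] /=.
  exact/word_over_cons.
by move=> h; case: ifP => _; [case/word_over_cons: h|apply/word_over_cons].
Qed.

Section Fold.
Variables (T : Type) (step : F * bool -> T -> T) (B : set F).
Hypothesis stepK : forall a t, B a.1 -> step a (step (inv_letter a) t) = t.

Lemma foldr_reduction z w : word_over B w -> foldr step z (reduction w) = foldr step z w.
Proof.
elim: w => //= a w IH /word_over_cons[Ba ow].
have := reduction_over ow; rewrite -(IH ow) /push; case: (reduction w) => // c w' /word_over_cons[Bc _].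
by case: eqP => //= ->; rewrite stepK.
Qed.

End Fold.

Lemma word_valueE w : word_value w = foldr (fun a t => letter a * t) 1 w.
Proof. by elim: w => [|a w IH]; rewrite ?word_value_nil // word_value_cons IH. Qed.

Lemma word_value_reduction w : word_value (reduction w) = word_value w.
Proof.
rewrite !word_valueE (@foldr_reduction _ _ setT) // => a t _.
by rewrite letter_inv mulVKg.
Qed.

(* The universal property of a free basis: letters acting invertibly on a set. *)
Lemma foldr_word_value T (step : F * bool -> T -> T) G B z u v :
  free_basis G B ->
  (forall a t, B a.1 -> step a (step (inv_letter a) t) = t) ->
  word_over B u -> word_over B v -> word_value u = word_value v ->
  foldr step z u = foldr step z v.
Proof.
move=> fB sK ou ov e; rewrite -(foldr_reduction sK z ou) -(foldr_reduction sK z ov).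
rewrite (@reduced_uniq G B (reduction u) (reduction v)) //.
- exact: reduced_reduction.
- exact: reduced_reduction.
- exact: reduction_over.
- exact: reduction_over.
- by rewrite !word_value_reduction.
Qed.

Definition word_of B x : word F := xget [::] [set w | word_over B w /\ word_value w = x].

Lemma word_ofP G B x : free_basis G B -> G x ->
  word_over B (word_of B x) /\ word_value (word_of B x) = x.
Proof.
move=> [<- _] /generatedE[w ow vw]; rewrite /word_of; case: xgetP => [_ -> //|/(_ w)].
by case.
Qed.

End Words.

(** * The Magnus order on a free group *)

Record biorder (F : groupType) := Biorder {
  lt_of :> F -> F -> Prop;
  bi_irr : forall x, ~ lt_of x x;
  bi_trans : forall y x z, lt_of x y -> lt_of y z -> lt_of x z;
  bi_total : forall x y, [\/ lt_of x y, x = y | lt_of y x];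
  bi_mull : forall z x y, lt_of x y -> lt_of (z * x) (z * y);
  bi_mulr : forall z x y, lt_of x y -> lt_of (x * z) (y * z) }.

Section Magnus.
Context {F : groupType}.
Implicit Types (f g h p q r : seq F -> int) (w u v : seq F).
Local Open Scope ring_scope.

(** Product of power series in noncommuting variables, a series being its coefficient function on
    monomials. The first term cuts [w] before its first letter, the second shifts [f] past that
    letter. *)
Fixpoint conv f g w : int :=
  if w is y :: w' then f [::] * g w + conv (fun u => f (y :: u)) g w' else f [::] * g [::].

Lemma convDl f f' g w : conv (fun u => f u + f' u) g w = conv f g w + conv f' g w.
Proof.
elim: w f f' => [|y w IH] f f' /=; first by rewrite mulrDl.
by rewrite (IH (fun u => f (y :: u)) (fun u => f' (y :: u))) mulrDl addrACA.
Qed.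

Lemma convDr f g g' w : conv f (fun u => g u + g' u) w = conv f g w + conv f g' w.
Proof.
elim: w f => [|y w IH] f /=; first by rewrite mulrDr.
by rewrite IH mulrDr addrACA.
Qed.

Lemma conv0l g w : conv (fun=> 0) g w = 0.
Proof. by elim: w => [|y w IH] /=; rewrite mul0r ?IH ?addr0. Qed.

Definition magnus1 : seq F -> int := fun w => (w == [::])%:R.

Lemma conv1l g w : conv magnus1 g w = g w.
Proof. by case: w => [|y w] /=; rewrite mul1r // conv0l addr0. Qed.

Lemma conv1r f w : conv f magnus1 w = f w.
Proof. by elim: w f => [|y w IH] f /=; rewrite ?mulr1 // IH mulr0 add0r. Qed.

Definition mul1X x f w := f w + (if w is y :: w' then if y == x then f w' else 0 else 0).

(** Left multiplication by the inverse of 1 + X, solving h = f - X h. *)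
Fixpoint mul1XV x f w :=
  f w - (if w is y :: w' then if y == x then mul1XV x f w' else 0 else 0).

Lemma mul1XK x f : mul1X x (mul1XV x f) = f.
Proof. by apply/funext; case=> [|y w]; rewrite /mul1X /= ?subr0 ?addr0 // subrK. Qed.

Lemma mul1XVK x f : mul1XV x (mul1X x f) = f.
Proof.
apply/funext; elim=> [|y w IH] /=; first by rewrite /mul1X subr0 addr0.
by rewrite IH /mul1X /= addrK.
Qed.

(* The Magnus embedding sends x to 1 + X. *)
Definition magnus_step (a : F * bool) f := if a.2 then mul1XV a.1 f else mul1X a.1 f.

Lemma magnus_stepK a f : magnus_step a (magnus_step (inv_letter a) f) = f.
Proof. by case: a => x [] /=; [apply: mul1XVK|apply: mul1XK]. Qed.

Lemma conv_mul1X x f g : conv (mul1X x f) g = mul1X x (conv f g).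
Proof.
apply/funext; case=> [|y w]; first by rewrite /mul1X /= !addr0.
rewrite /= {1 3}/mul1X /= addr0 -addrA; congr (_ + _).
rewrite convDl; congr (_ + _); case: eqP => // _; exact: conv0l.
Qed.

Lemma conv_magnus_step a f g : conv (magnus_step a f) g = magnus_step a (conv f g).
Proof.
rewrite /magnus_step; case: a.2; last exact: conv_mul1X.
by rewrite -[LHS](mul1XVK a.1) -conv_mul1X mul1XK.
Qed.

Definition magnus_word (w : word F) := foldr magnus_step magnus1 w.

Lemma magnus_word_cat (u v : word F) : magnus_word (u ++ v) = conv (magnus_word u) (magnus_word v).
Proof.
elim: u => [|a u IH] /=; first by apply/funext=> w; rewrite conv1l.
by rewrite -[LHS]/(magnus_step a (magnus_word (u ++ v))) IH -conv_magnus_step.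
Qed.

Lemma magnus_word_nil (w : word F) : magnus_word w [::] = 1.
Proof.
by elim: w => //= -[x b] w <-; rewrite /magnus_word /magnus_step /=; case: b; rewrite /mul1X /= ?addr0 ?subr0.
Qed.

Definition vanish_below d f := forall w, (size w < d)%N -> f w = 0.

Lemma conv_vanish d f p w : vanish_below d p -> (size w < d)%N -> conv f p w = 0.
Proof.
move=> lp; elim: w f => [|y w IH] f sw /=; first by rewrite lp ?mulr0.
by rewrite lp // mulr0 add0r IH // ltnW.
Qed.

(** A factor without constant term raises the order by one; hence a product of two tails does not
    reach the lowest degree of either. *)
Lemma conv_vanishr d r p w :
  r [::] = 0 -> vanish_below d p -> (size w <= d)%N -> conv r p w = 0.
Proof.
move=> r0 lp; case: w => [|y w] sw /=; rewrite r0 mul0r // add0r.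
exact: conv_vanish lp _.
Qed.

Lemma conv_vanishl d q r w :
  r [::] = 0 -> vanish_below d q -> (size w <= d)%N -> conv q r w = 0.
Proof.
move=> r0; elim: w q d => [|y w IH] q d lq sw /=; first by rewrite r0 mulr0.
case: d lq sw => // d lq sw; rewrite lq // mul0r add0r (IH _ d) //.
by move=> u su; apply: lq.
Qed.

End Magnus.

(** * Injectivity of the Magnus embedding *)

Section MagnusInjective.
Context {F : groupType}.
Implicit Types (w u v s : seq F) (f : seq F -> int).
Local Open Scope ring_scope.

Lemma mul1X_head_neq x y f s : y != x -> mul1X x f (y :: s) = f (y :: s).
Proof. by move=> /negbTE h; rewrite /mul1X h addr0. Qed.

Lemma mul1XV_head_neq x y f s : y != x -> mul1XV x f (y :: s) = f (y :: s).
Proof. by move=> /negbTE h; rewrite /= h subr0. Qed.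

Lemma magnus_step_head_neq (a : F * bool) y f s :
  y != a.1 -> magnus_step a f (y :: s) = f (y :: s).
Proof. by rewrite /magnus_step; case: a.2 => /=; [apply: mul1XV_head_neq|apply: mul1X_head_neq]. Qed.

Lemma magnus_step_suffix0 (a : F * bool) f z s :
  z != a.1 -> (forall u, f (u ++ z :: s) = 0) ->
  forall u, magnus_step a f (u ++ z :: s) = 0.
Proof.
move=> /negbTE za f0; rewrite /magnus_step; case: a.2; elim=> [|y u IH].
- by rewrite /= za subr0 (f0 [::]).
- by rewrite /= IH (f0 (y :: u)) if_same subr0.
- by rewrite /mul1X /= za addr0 (f0 [::]).
- by rewrite /mul1X /= (f0 (y :: u)) f0 if_same addr0.
Qed.

(* [x :: s] lists the successive generators of the reduced word, without
   repetition; its coefficient is the product of the exponents. *)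
Lemma magnus_syllables (a : F * bool) (w : word F) : reduced (a :: w) ->
  exists s (c : int) (n : nat),
    [/\ forall t, ohead s = Some t -> t != a.1, c != 0,
        magnus_word (a :: w) s = c,
        magnus_word (a :: w) (a.1 :: s) = (-1) ^+ a.2 * n.+1%:R * c
      & forall u y, y != a.1 -> magnus_word (a :: w) (u ++ y :: a.1 :: s) = 0].
Proof.
elim: w a => [|b w IH] a rw.
  exists [::], 1, 0%N; split=> //.
  - exact: magnus_word_nil.
  - by rewrite /magnus_word /= /magnus_step /mul1X; case: a.2; rewrite /= eqxx.
  - move=> u y ya; apply: magnus_step_suffix0 => // u'; by case: u'.
have /IH[s [c [n [hs c0 es exs vs]]]] := path_sorted rw.
have cab : compatible a b by case/andP: rw.
set f := magnus_word (b :: w) in vs es exs *.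
rewrite -[magnus_word [:: a, b & w]]/(magnus_step a f).
(* Same syllable: reducedness makes the signs agree, and the exponent grows from n.+1 to n.+2 in
   absolute value. *)
have [ab|ab] := eqVneq b.1 a.1.
  have sab : b.2 = a.2 by move: cab; rewrite /compatible ab eqxx /= negbK => /eqP.
  rewrite ab sab in hs exs vs.
  have fs : magnus_step a f s = c.
    case: s hs es {vs exs} => [|t s] hs es; last first.
      by rewrite magnus_step_head_neq; [exact: es|exact: hs].
    by rewrite /magnus_step; case: a.2; rewrite /= /mul1X ?subr0 ?addr0.
  exists s, c, n.+1; split=> //.
    rewrite -[n.+2]addn1 natrD mulrDr mulrDl -exs mulr1.
    move: fs; rewrite /magnus_step /mul1X; case: a.2 => [|_] /=; rewrite eqxx ?expr1 ?mulN1r.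
      by move=> ->.
    by rewrite expr0 mul1r es.
  move=> u y ya; apply: magnus_step_suffix0 => // u'.
  exact: vs.
exists (b.1 :: s), ((-1) ^+ b.2 * n.+1%:R * c), 0%N.
have fs : magnus_step a f (b.1 :: s) = (-1) ^+ b.2 * n.+1%:R * c.
  by rewrite magnus_step_head_neq.
(* New syllable: this monomial is absent from the shorter word, so its coefficient comes from the
   factor [a] alone, with exponent 1 or -1. *)
have f0 : f (a.1 :: b.1 :: s) = 0 by apply: (vs [::]); rewrite eq_sym.
split=> //.
- by move=> t [<-].
- by rewrite !mulf_eq0 signr_eq0 pnatr_eq0 (negbTE c0).
- move: fs; rewrite /magnus_step /mul1X; case: a.2 => [|_] /=; rewrite eqxx f0 mulr1 ?expr1.
    by move=> ->; rewrite mulN1r add0r.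
  by rewrite add0r expr0 mul1r exs.
- move=> u y ya; apply: magnus_step_suffix0 => // u'.
  by rewrite -cat1s catA; apply: vs; rewrite eq_sym.
Qed.

End MagnusInjective.

(** * The positive cone of the order *)

Section MagnusOrder.
Context {F : groupType}.
Variables (B : set F).
Hypothesis fB : free_basis setT B.
Implicit Types (w u v : seq F) (f p q r : seq F -> int) (x y z : F).
Local Open Scope ring_scope.

Definition magnus x := magnus_word (word_of B x).

Lemma magnusE (w : word F) : word_over B w -> magnus (word_value w) = magnus_word w.
Proof.
move=> ow; have [o e] := word_ofP (x := word_value w) fB I.
apply: (foldr_word_value _ fB) => // a t _; exact: magnus_stepK.
Qed.

Lemma magnusM x y : magnus (x * y)%g = conv (magnus x) (magnus y).
Proof.
have [ox ex] := word_ofP (x := x) fB I; have [oy ey] := word_ofP (x := y) fB I.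
rewrite -{1}ex -{1}ey -word_value_cat magnusE; last exact/word_over_cat.
exact: magnus_word_cat.
Qed.

Lemma magnus_one : magnus 1%g = magnus1.
Proof. by rewrite -word_value_nil magnusE. Qed.

Lemma magnus_eq1 x : magnus x = magnus1 -> x = 1%g.
Proof.
have [ox ex] := word_ofP (x := x) fB I.
have rx := reduced_reduction (word_of B x).
have orx := reduction_over ox.
rewrite -{1 2}ex -word_value_reduction magnusE //.
case: (reduction _) rx orx => [|a w] rw _; first by rewrite word_value_nil.
have [s [c [n [_ c0 _ e _]]]] := magnus_syllables rw.
move=> ew; move: e; rewrite ew /magnus1 /= => /esym/eqP.
by rewrite !mulf_eq0 signr_eq0 (negbTE c0) orbF /= pnatr_eq0.
Qed.

Definition tail x w : int := magnus x w - magnus1 w.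

Lemma tailE x w : magnus x w = magnus1 w + tail x w.
Proof. by rewrite /tail addrC subrK. Qed.

Lemma tail_nil x : tail x [::] = 0.
Proof. by rewrite /tail /magnus magnus_word_nil subrr. Qed.

Lemma magnus_tail x : magnus x = (fun w => magnus1 w + tail x w).
Proof. by apply/funext => w; rewrite tailE. Qed.

Lemma tailM x y w : tail (x * y)%g w = tail x w + tail y w + conv (tail x) (tail y) w.
Proof.
rewrite {1}/tail magnusM [magnus x]magnus_tail [magnus y]magnus_tail.
rewrite convDl !convDr !conv1l conv1r addrAC [magnus1 w + _]addrC addrK.
by rewrite addrA [tail y w + _]addrC.
Qed.

Let R := sval (well_ordering_principle (seq F)).
Let woR : well_order R := svalP (well_ordering_principle (seq F)).

Let RR : [/\ transitive R, forall w v, R w v -> R v w -> w = v & total R].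
Proof.
have wR : wo_chain R predT by move=> A _; apply: woR.
have anti w v : R w v -> R v w -> w = v.
  by move=> wv vw; apply: (wo_chain_antisymmetric wR) => //; rewrite wv.
split=> // [y x z xy yz|w v]; last exact: (wo_chainW wR).
have [|m [[]]] := woR (A := mem [:: x; y; z]); first by exists x; apply: mem_head.
rewrite !inE => mE lm _; have [mx my mz] : [/\ R m x, R m y & R m z].
  by split; apply: lm; rewrite !inE eqxx ?orbT.
case/or3P: mE => /eqP e; rewrite e in mx my mz => //.
  by rewrite (anti x y).
by rewrite -(anti y z).
Qed.

(** Degree first, then an arbitrary well-order [R]. Products and conjugates are compared only up to
    the lowest degree, where tails add and a product of two tails contributes nothing. *)
Definition wle w v := (size w < size v)%N || ((size w == size v) && R w v).

Let wle_anti w v : wle w v -> wle v w -> w = v.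
Proof.
have [_ anti _] := RR.
rewrite /wle => /orP[wv|/andP[/eqP-> wv]] /orP[vw|/andP[/eqP e vw]].
- by rewrite ltnNge ltnW in wv.
- by rewrite e ltnn in wv.
- by rewrite ltnn in vw.
- exact: anti.
Qed.

Let wle_total w v : wle w v || wle v w.
Proof.
have [_ _ tot] := RR.
by rewrite /wle; case: ltngtP => //= _; apply: tot.
Qed.

Let wle_size w v : wle w v -> (size w <= size v)%N.
Proof. by case/orP=> [/ltnW|/andP[/eqP->]]. Qed.

Let wle_trans w v u : wle w v -> wle v u -> wle w u.
Proof.
have [tr _ _] := RR.
rewrite /wle => /orP[wv|/andP[/eqP-> wv]] /orP[vu|/andP[/eqP<- vu]].
- by rewrite (ltn_trans wv vu).
- by rewrite wv.
- by rewrite vu.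
- by rewrite eqxx (tr _ _ _ wv vu) orbT.
Qed.

Definition leading f w := f w != 0 /\ forall v, f v != 0 -> wle w v.

Lemma leading_exists f : (exists w, f w != 0) -> exists w, leading f w.
Proof.
move=> [w0 f0].
have ex : exists n, `[< exists w, size w = n /\ f w != 0 >].
  by exists (size w0); apply/asboolP; exists w0.
have [n /asboolP[w [sw fw]] min] := ex_minnP ex.
have [|u [[/asboolP[su fu] lb] _]] := woR (A := [pred v | `[< size v = n /\ f v != 0 >]]).
  by exists w; apply/asboolP.
exists u; split=> // v fv; rewrite /wle su.
have nv : (n <= size v)%N by apply: min; apply/asboolP; exists v.
move: nv; rewrite leq_eqVlt => /orP[/eqP e|-> //].
by rewrite e eqxx ltnn /=; apply: lb; apply/asboolP.
Qed.

Lemma leading_vanish f w : leading f w -> vanish_below (size w) f.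
Proof.
move=> [_ h] v sv; apply/eqP; apply: contraTT sv => /h /wle_size.
by rewrite -leqNgt.
Qed.

Definition mpos x := exists2 w, leading (tail x) w & 0 < tail x w.

(** At the smaller of the two leading monomials both coefficients are nonnegative and one is
    positive, so nothing cancels. [k] will be the product of two tails. *)
Lemma leading_sum f g k w1 w2 : leading f w1 -> leading g w2 -> 0 < f w1 -> 0 < g w2 ->
  (forall v, (size v <= maxn (size w1) (size w2))%N -> k v = 0) ->
  exists2 w, leading (fun v => f v + g v + k v) w & 0 < f w + g w + k w.
Proof.
wlog w12 : f g w1 w2 / wle w1 w2 => [H|].
  have /orP[/H|w21] := wle_total w1 w2; first exact.
  move=> l1 l2 p1 p2; rewrite maxnC => /(H _ _ _ _ w21 l2 l1 p2 p1)[w lw pw].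
  exists w; last by rewrite [f w + _]addrC.
  by under [X in leading X]funext => v do rewrite [f v + _]addrC.
move=> l1 l2 p1 p2 k0.
have fg : 0 <= g w1.
  have [->//|/(l2.2 _)w21] := eqVneq (g w1) 0.
  by rewrite (wle_anti w12 w21) ltW.
have kw : k w1 = 0 by rewrite k0 // leq_maxl.
have p : 0 < f w1 + g w1 + k w1 by rewrite kw addr0 ltr_wpDr.
exists w1 => //; split=> [|v]; first by rewrite gt_eqF.
apply: contraNT => wv; have vw : wle v w1 by have := wle_total w1 v; rewrite (negbTE wv).
rewrite k0 ?addr0; last by rewrite leq_max wle_size.
have -> : f v = 0 by apply/eqP; apply: contraNT wv; apply: l1.2.
have -> : g v = 0 by apply/eqP; apply: contraNT wv => /(l2.2 _); apply: wle_trans.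
by rewrite addr0.
Qed.

Lemma mposM x y : mpos x -> mpos y -> mpos (x * y)%g.
Proof.
move=> [w1 l1 p1] [w2 l2 p2].
have [v|w lw pw] := leading_sum (k := conv (tail x) (tail y)) l1 l2 p1 p2.
  rewrite leq_max => /orP[] sv.
    by apply: conv_vanishl sv; [apply: tail_nil|apply: leading_vanish].
  by apply: conv_vanishr sv; [apply: tail_nil|apply: leading_vanish].
have e : tail (x * y)%g = (fun v => tail x v + tail y v + conv (tail x) (tail y) v).
  by apply/funext => v; apply: tailM.
by exists w; rewrite e.
Qed.

Lemma tail1 w : tail 1%g w = 0.
Proof. by rewrite /tail magnus_one subrr. Qed.

Lemma mpos1 : ~ mpos 1%g.
Proof. by case=> w _; rewrite tail1 ltxx. Qed.

(* The lowest homogeneous part of a conjugate is unchanged. *)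
Lemma mposJ x y : mpos y -> mpos (x * y * x^-1)%g.
Proof.
move=> [w lw pw]; set z := (x * y * x^-1)%g.
have e v : tail z v + conv (tail z) (tail x) v = tail y v + conv (tail x) (tail y) v.
  have : tail (z * x)%g v = tail (x * y)%g v by rewrite /z mulgVK.
  rewrite (tailM z x) (tailM x y) => h; apply: (@addrI _ (tail x v)); rewrite /=.
  by rewrite addrA [tail x v + tail z v]addrC h -addrA.
have agree d : vanish_below d (tail z) -> vanish_below d (tail y) ->
    forall v, (size v <= d)%N -> tail z v = tail y v.
  move=> lz ly v sv; have := e v.
  by rewrite (conv_vanishl _ lz) ?(conv_vanishr _ ly) ?addr0 //; apply: tail_nil.
have vy := leading_vanish lw.
(* Degree by degree: once both tails vanish below n, they agree in degree n by [agree], and that of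
   [y] vanishes there. *)
have vz n : (n <= size w)%N -> vanish_below n (tail z).
  elim: n => [|n IH] nw v //; rewrite ltnS => sv.
  have vyn : vanish_below n (tail y) by move=> u su; apply: vy; apply: leq_trans su (ltnW nw).
  by rewrite (agree n (IH (ltnW nw)) vyn) // vy // (leq_ltn_trans sv).
have a := agree _ (vz _ (leqnn _)) vy.
exists w; last by rewrite a.
split=> [|v]; first by rewrite a // gt_eqF.
move=> zv; have [sv|sv] := leqP (size v) (size w); last by rewrite /wle sv.
by apply: lw.2; rewrite -a.
Qed.

Lemma mpos_total x : x <> 1%g -> mpos x \/ mpos x^-1%g.
Proof.
move=> x1; have [w lw] : exists w, leading (tail x) w.
  apply: leading_exists; apply: contrapT => h; apply: x1; apply: magnus_eq1.
  by apply/funext => w; apply/eqP; rewrite -subr_eq0; apply: contra_notT h => nz; exists w.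
have : tail x w != 0 by case: lw.
rewrite neq_lt => /orP[neg|pos]; [right|by left; exists w].
have a v : (size v <= size w)%N -> tail x^-1%g v = - tail x v.
  move=> sv; have := tailM x x^-1%g v; rewrite mulgV tail1.
  rewrite (conv_vanishl _ (leading_vanish lw)) ?addr0 //; last exact: tail_nil.
  by move/esym/eqP; rewrite addrC addr_eq0 => /eqP.
exists w; last by rewrite a // oppr_gt0.
split=> [|v]; first by rewrite a // oppr_eq0; case: lw.
move=> zv; have [sv|sv] := leqP (size v) (size w); last by rewrite /wle sv.
by apply: lw.2; rewrite -oppr_eq0 -a.
Qed.

Lemma free_biorder : biorder F.
Proof.
apply: (@Biorder F (fun x y => mpos (x^-1 * y)%g)).
- by move=> x; rewrite mulVg; apply: mpos1.
- by move=> y x z xy yz; have := mposM xy yz; rewrite mulgA mulgK.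
- move=> x y; have [->|xy] := pselect (x = y); first exact: Or32.
  have [|p|] := @mpos_total (x^-1 * y)%g; last by rewrite invgM invgK; apply: Or33.
    by move/mulg1_eq; rewrite invgK.
  exact: Or31.
- by move=> z x y; rewrite invgM -mulgA mulKg.
- move=> z x y /(mposJ z^-1); by rewrite invgM invgK !mulgA.
Qed.

End MagnusOrder.

(** * Malcev-Neumann series *)

Section WellOrderedSubsets.
Context {F : groupType}.
Variable o : biorder F.
Implicit Types (S T A : set F) (x y z : F).

Definition wo S := forall A, A `<=` S -> A !=set0 -> exists2 m, A m & forall x, A x -> ~ o x m.

Lemma wo_sub S T : S `<=` T -> wo T -> wo S.
Proof. by move=> ST wT A AS; apply: wT => x /AS/ST. Qed.

Lemma wo_set1 x : wo [set x].
Proof. by move=> A Ax [y Ay]; exists y => // z /Ax ->; rewrite (Ax _ Ay); apply: bi_irr. Qed.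

Lemma bi_asym x y : o x y -> ~ o y x.
Proof. by move=> xy /(bi_trans xy); apply: bi_irr. Qed.

Lemma bi_le_lt x y z : ~ o y x -> o y z -> o x z.
Proof.
move=> yx yz; have [|e|/(bi_trans yz)//] := bi_total o x z; first by [].
by case: yx; rewrite e.
Qed.

Lemma bi_lt_le x y z : o x y -> ~ o z y -> o x z.
Proof.
move=> xy zy; have [|e|/bi_trans/(_ xy)//] := bi_total o x z; first by [].
by case: zy; rewrite -e.
Qed.

Lemma woU S T : wo S -> wo T -> wo (S `|` T).
Proof.
move=> wS wT A AST [a Aa].
have [e|/set0P ne] := eqVneq (A `&` S) set0.
  apply: wT; last by exists a.
  by move=> x Ax; case: (AST x Ax) => // Sx; have : set0 x by rewrite -e.
have [m [Am Sm] lm] := wS _ (@subIsetr _ _ _) ne.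
have [e|/set0P nt] := eqVneq (A `&` T) set0.
  exists m => // x Ax; apply: lm; split=> //.
  by case: (AST x Ax) => // Tx; have : set0 x by rewrite -e.
have [n [An Tn] ln] := wT _ (@subIsetr _ _ _) nt.
have [mn|mn] := pselect (o m n).
  exists m => // x Ax; case: (AST x Ax) => [Sx|Tx]; first exact: lm.
  by move=> /bi_trans/(_ mn); apply: ln.
exists n => // x Ax; case: (AST x Ax) => [Sx|Tx]; last exact: ln.
by move=> /bi_lt_le/(_ mn); apply: lm.
Qed.

Lemma wo_ind S (P : F -> Prop) : wo S ->
  (forall x, S x -> (forall y, S y -> o y x -> P y) -> P x) -> forall x, S x -> P x.
Proof.
move=> wS IH x Sx; apply: contrapT => nP.
have [|m [Sm nPm] lm] := wS [set y | S y /\ ~ P y] (fun y h => proj1 h); first by exists x.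
apply: nPm; apply: IH => // y Sy ym; apply: contrapT => nPy.
exact: (lm y).
Qed.

(** Induction on the second factor. Let x be the least first factor occurring in A, with x * y in A:
    a product below x * y has its first factor at least x, hence its second factor below y. *)
Lemma wo_mul S T : wo S -> wo T -> wo [set z | exists x y, [/\ S x, T y & z = x * y]].
Proof.
move=> wS wT.
pose ST U := [set z | exists x y, [/\ S x, U y & z = x * y]].
have step U : U `<=` T -> (forall y, U y -> wo (ST (U `&` (fun y' => o y' y)))) -> wo (ST U).
  move=> UT IH A AST [a Aa].
  have [||x [y [Uy Axy Sx]] lx] := wS [set x | exists y, [/\ U y, A (x * y) & S x]].
  - by move=> x [y []].
  - by case: (AST a Aa) => x [y [Sx Uy e]]; exists x, y; rewrite -e.
  have [ex|ne] := pselect (exists2 z, A z & o z (x * y)); last first.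
    by exists (x * y) => // z Az h; apply: ne; exists z.
  case: ex => z Az zxy.
  have [||m [Am mxy] lm] := IH y Uy [set z | A z /\ o z (x * y)]; last first.
  - exists m => // w Aw wm; apply: (lm w _ wm); split=> //.
    exact: bi_trans wm mxy.
  - by exists z.
  - move=> w [Aw wxy]; case: (AST w Aw) => x' [y' [Sx' Uy' e]].
    exists x', y'; split=> //; split=> //.
    have xx' : ~ o x' x by apply: lx; exists y'; rewrite -e.
    have [//|e'|yy'] := bi_total o y' y.
      rewrite e e' in wxy; have [h|h|h] := bi_total o x x'; last by case: (xx' h).
        by case: (bi_asym wxy); apply: bi_mulr.
      by move: wxy; rewrite h => /bi_irr.
    case: (bi_asym wxy); rewrite e; apply: bi_le_lt (bi_mull x' yy').
    move=> /(bi_mulr y^-1); rewrite !mulgK; exact: xx'.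
suff IH y : T y -> wo (ST (T `&` (fun y' => o y' y))).
  by apply: (step T) => // y Ty; apply: IH.
move: y; apply: (wo_ind wT) => y Ty IH; apply: step => [x []//|z [Tz zy]].
apply: wo_sub (IH z Tz zy) => w [x [x' [Sx [[Tx' x'y] x'z] e]]].
by exists x, x'; split.
Qed.

Lemma wo_dual_finite S : wo S ->
  (forall A, A `<=` S -> A !=set0 -> exists2 m, A m & forall x, A x -> ~ o m x) -> finite_set S.
Proof.
move=> wS dS.
have below U : U `<=` S -> (forall x, U x -> finite_set (U `&` (fun y => o y x))) -> finite_set U.
  move=> US fU; have [->|/set0P ne] := eqVneq U set0; first exact: finite_set0.
  have [m Um hm] := dS U US ne.
  apply: (@sub_finite_set _ _ ((U `&` (fun y => o y m)) `|` [set m])).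
    move=> x Ux; have [|->|mx] := bi_total o x m; [by left|by right|].
    by case: (hm x Ux).
  by rewrite finite_setU; split; [apply: fU|apply: finite_set1].
apply: (below S) => // x Sx; move: x Sx; apply: (wo_ind wS) => x Sx IH.
apply: (below _) => [y []//|y [Sy yx]].
by apply: sub_finite_set (IH y Sy yx) => z [[Sz _] zy].
Qed.

(** As x grows, x^-1 * z decreases inside the well-ordered [T], so the fibre is well-ordered in both
    directions. This makes every coefficient of a product a finite sum. *)
Lemma wo_fiber_finite S T z : wo S -> wo T -> finite_set [set x | S x /\ T (x^-1 * z)].
Proof.
move=> wS wT; apply: wo_dual_finite => [|A AST [a Aa]].
  by apply: wo_sub wS => x [].
have [||m Am lm] := wT [set x^-1 * z | x in A].
- by move=> _ [x /AST[_ Tx] <-].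
- by exists (a^-1 * z), a.
case: Am => x Ax e; exists x => // y Ay xy.
apply: (lm (y^-1 * z)); first by exists y.
rewrite -e; apply: bi_mulr; have := bi_mulr x^-1 (bi_mull y^-1 xy).
by rewrite mulVg mul1g mulgK.
Qed.

End WellOrderedSubsets.
Arguments wo_set1 {F} o x.

(** * Finitely supported sums *)

Section FiniteSums.
Context {T : choiceType}.
Implicit Types (f g : T -> rat) (A : set T).
Local Open Scope ring_scope.

Lemma fsum_widen A f : (forall x, f x != 0 -> A x) ->
  \sum_(x \in [set: T]) f x = \sum_(x \in A) f x.
Proof.
move=> fA; apply/esym/fsbig_widen => // x [_ nA] /=.
by apply/eqP; apply: contra_notT nA => /fA.
Qed.

(** A sum of infinite support is 0 by default, hence the common finite set [A]. *)
Lemma fsumD A f g : finite_set A -> (forall x, f x != 0 -> A x) -> (forall x, g x != 0 -> A x) ->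
  \sum_(x \in [set: T]) (f x + g x) = \sum_(x \in [set: T]) f x + \sum_(x \in [set: T]) g x.
Proof.
move=> fA hf hg; rewrite !(@fsum_widen A) //; first exact: fsbig_split.
move=> x; apply: contra_neqP => nA.
have -> : f x = 0 by apply/eqP; apply: contra_notT nA => /hf.
have -> : g x = 0 by apply/eqP; apply: contra_notT nA => /hg.
by rewrite addr0.
Qed.

Lemma fsum_exchange (U : choiceType) (h : T -> U -> rat) A (B : set U) :
  finite_set A -> finite_set B -> (forall x y, h x y != 0 -> A x /\ B y) ->
  \sum_(x \in [set: T]) \sum_(y \in [set: U]) h x y =
  \sum_(y \in [set: U]) \sum_(x \in [set: T]) h x y.
Proof.
move=> fA fB hAB.
have eB x : \sum_(y \in [set: U]) h x y = \sum_(y \in B) h x y.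
  apply/esym/fsbig_widen => // y [_ nB] /=.
  by apply/eqP; apply: contra_notT nB => /hAB[].
have eA y : \sum_(x \in [set: T]) h x y = \sum_(x \in A) h x y.
  by apply: fsum_widen => x /hAB[].
rewrite (@fsum_widen A); last first.
  by move=> x /fsbigN1[y _ /hAB[]].
rewrite [RHS](_ : _ = \sum_(y \in B) \sum_(x \in [set: T]) h x y); last first.
  apply/esym/fsbig_widen => // y [_ nB] /=.
  by rewrite fsbig1 // => x _; apply/eqP; apply: contra_notT nB => /hAB[].
under eq_fsbigr do rewrite eB.
under [RHS]eq_fsbigr do rewrite eA.
exact: exchange_fsbig.
Qed.

End FiniteSums.

(** * The ring of series and its subrings D_G *)

Record series (F : groupType) (o : biorder F) := Series {
  coef :> F -> rat;
  coef_wo : wo o [set x | coef x != 0%R] }.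

Arguments coef_wo {F o} s.

Section Series.
Context {F : groupType} {o : biorder F}.
Local Notation D := (series o).
Implicit Types (f g h : D) (x y z : F) (c : rat) (G : set F).
Local Open Scope ring_scope.

HB.instance Definition _ := gen_eqMixin D.
HB.instance Definition _ := gen_choiceMixin D.

Lemma seriesP f g : (forall x, f x = g x) -> f = g.
Proof.
case: f g => [f wf] [g wg] /= /funext e; rewrite e in wf *.
by congr Series; apply: Prop_irrelevance.
Qed.

Lemma zero_wo : wo o [set x : F | (0 : rat) != 0].
Proof. by move=> A A0 [x /A0 /eqP]. Qed.

Lemma add_wo f g : wo o [set x | f x + g x != 0].
Proof.
apply: wo_sub (woU (coef_wo f) (coef_wo g)) => x /=.
by have [->|] := eqVneq (f x) 0; [rewrite add0r; right|left].
Qed.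

Lemma opp_wo f : wo o [set x | - f x != 0].
Proof. by apply: wo_sub (coef_wo f) => x /=; rewrite oppr_eq0. Qed.

Lemma sing_wo z c : wo o [set x | (if x == z then c else 0) != 0].
Proof. by apply: wo_sub (wo_set1 o z) => x; rewrite /=; have [->|_] := eqVneq x z => // /eqP. Qed. 

Definition conv_coef (f g : F -> rat) z := \sum_(x \in [set: F]) f x * g (x^-1 * z)%g.

Lemma conv_term_neq0 (f g : F -> rat) x z :
  f x * g (x^-1 * z)%g != 0 -> [set x | f x != 0 /\ g (x^-1 * z)%g != 0] x.
Proof. by rewrite mulf_eq0 negb_or => /andP. Qed.

Lemma conv_coef_neq0 (f g : F -> rat) z : conv_coef f g z != 0 ->
  exists x, f x != 0 /\ g (x^-1 * z)%g != 0.
Proof.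
apply: contra_neqP => h; rewrite /conv_coef fsbig1 // => x _.
by apply/eqP; apply: contra_notT h => /conv_term_neq0; exists x.
Qed.

Lemma mul_wo f g : wo o [set x | conv_coef f g x != 0].
Proof.
apply: wo_sub (wo_mul (coef_wo f) (coef_wo g)) => z /conv_coef_neq0[x [fx gx]].
by exists x, (x^-1 * z)%g; split=> //; rewrite mulVKg.
Qed.

Arguments add_wo f g : clear implicits.
Arguments opp_wo f : clear implicits.
Arguments sing_wo z c : clear implicits.
Arguments mul_wo f g : clear implicits.

Definition szero : D := Series zero_wo.
Definition sadd f g : D := Series (add_wo f g).
Definition sopp f : D := Series (opp_wo f).
Definition sing z c : D := Series (sing_wo z c).
Definition smul f g : D := Series (mul_wo f g).

Lemma saddA : associative sadd.
Proof. by move=> f g h; apply: seriesP => x /=; rewrite addrA. Qed.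
Lemma saddC : commutative sadd.
Proof. by move=> f g; apply: seriesP => x /=; rewrite addrC. Qed.
Lemma sadd0 : left_id szero sadd.
Proof. by move=> f; apply: seriesP => x /=; rewrite add0r. Qed.
Lemma saddN : left_inverse szero sopp sadd.
Proof. by move=> f; apply: seriesP => x /=; rewrite addNr. Qed.

HB.instance Definition _ := GRing.isZmodule.Build D saddA saddC sadd0 saddN.

Lemma scoefD f g x : (f + g) x = f x + g x. Proof. by []. Qed.
Lemma scoefN f x : (- f) x = - f x. Proof. by []. Qed.
Lemma scoef0 x : (0 : D) x = 0. Proof. by []. Qed.
Lemma scoefB f g x : (f - g) x = f x - g x. Proof. by []. Qed.
Lemma coef_sing z c x : sing z c x = if x == z then c else 0. Proof. by []. Qed.

Lemma fiber_finite f g z : finite_set [set x | f x != 0 /\ g (x^-1 * z)%g != 0].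
Proof. exact: wo_fiber_finite (coef_wo f) (coef_wo g). Qed.

Lemma smul_singl z c g x : smul (sing z c) g x = c * g (z^-1 * x)%g.
Proof.
rewrite /= /conv_coef (@fsum_widen _ [set z]) ?fsbig_set1 ?eqxx // => y /=.
by have [->//|_] := eqVneq y z; rewrite mul0r eqxx.
Qed.

Lemma smul_singr z c g x : smul g (sing z c) x = g (x * z^-1)%g * c.
Proof.
rewrite /= /conv_coef (@fsum_widen _ [set (x * z^-1)%g]).
  by rewrite fsbig_set1 invgM invgK mulgVK eqxx.
move=> y /=; have [<- _|_] := eqVneq _ z; last by rewrite mulr0 eqxx.
by rewrite invgM invgK mulVKg.
Qed.

Lemma smulDl : left_distributive smul +%R.
Proof.
move=> f g h; apply: seriesP => z; rewrite scoefD /= /conv_coef.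
under eq_fsbigr do rewrite mulrDl.
apply: (@fsumD _ ([set x | f x != 0 /\ h (x^-1 * z)%g != 0] `|`
                  [set x | g x != 0 /\ h (x^-1 * z)%g != 0])).
- by rewrite finite_setU; split; apply: fiber_finite.
- by move=> x /conv_term_neq0; left.
- by move=> x /conv_term_neq0; right.
Qed.

Lemma smulDr : right_distributive smul +%R.
Proof.
move=> h f g; apply: seriesP => z; rewrite scoefD /= /conv_coef.
under eq_fsbigr do rewrite mulrDr.
apply: (@fsumD _ ([set x | h x != 0 /\ f (x^-1 * z)%g != 0] `|`
                  [set x | h x != 0 /\ g (x^-1 * z)%g != 0])).
- by rewrite finite_setU; split; apply: fiber_finite.
- by move=> x /conv_term_neq0; left.
- by move=> x /conv_term_neq0; right.
Qed.

Lemma smulA : associative smul.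
Proof.
move=> f g h; apply: seriesP => z /=; rewrite /conv_coef.
transitivity (\sum_(x \in [set: F]) \sum_(y \in [set: F])
    f x * g (x^-1 * y)%g * h (y^-1 * z)%g).
  apply: eq_fsbigr => x _; rewrite /conv_coef mulr_fsumr.
  rewrite (@reindex_fsbigT _ _ _ _ _ (fun y => (x^-1 * y)%g)) /=; last first.
    by exists (fun y => (x * y)%g) => y; rewrite ?mulVKg ?mulKg.
  by apply: eq_fsbigr => y _; rewrite mulrA invgM invgK -mulgA mulVKg.
(* Exchanging the sums needs finite ranges for x and y; each is a fibre of one support against the
   product set of the other two. *)
pose PQ (p q : D) := [set w | exists x y, [/\ p x != 0, q y != 0 & w = (x * y)%g]].
have wPQ p q : wo o (PQ p q) := wo_mul (coef_wo p) (coef_wo q).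
rewrite (@fsum_exchange _ _ _ [set x | f x != 0 /\ PQ g h (x^-1 * z)%g]
   [set y | PQ f g y /\ h (y^-1 * z)%g != 0]).
- by apply: eq_fsbigr => y _; rewrite /conv_coef mulr_fsuml.
- exact: wo_fiber_finite (coef_wo f) (wPQ g h).
- exact: wo_fiber_finite (wPQ f g) (coef_wo h).
move=> x y; rewrite !mulf_eq0 !negb_or => /andP[/andP[fx gy] hz]; split; split=> //.
  by exists (x^-1 * y)%g, (y^-1 * z)%g; split=> //; rewrite mulgA mulgK.
by exists x, (x^-1 * y)%g; split=> //; rewrite mulVKg.
Qed.

Lemma smul1 : left_id (sing 1%g 1) smul.
Proof. by move=> f; apply: seriesP => x; rewrite smul_singl mul1r invg1 mul1g. Qed.

Lemma smulr1 : right_id (sing 1%g 1) smul.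
Proof. by move=> f; apply: seriesP => x; rewrite smul_singr mulr1 divg1. Qed.

Lemma sone_neq0 : sing 1%g 1 != 0 :> D.
Proof.
by apply/eqP => /(congr1 (fun f : D => f 1%g)); rewrite coef_sing eqxx scoef0 => /eqP; rewrite oner_eq0.
Qed.

HB.instance Definition _ :=
  GRing.Zmodule_isNzRing.Build D smulA smul1 smulr1 smulDl smulDr sone_neq0.

Lemma scoefM f g z : (f * g) z = \sum_(x \in [set: F]) f x * g (x^-1 * z)%g.
Proof. by []. Qed.

Lemma scoef1 x : (1 : D) x = if x == 1%g then 1 else 0. Proof. by []. Qed.

Lemma singlM z c g x : (sing z c * g) x = c * g (z^-1 * x)%g.
Proof. exact: smul_singl. Qed.

Lemma singrM z c g x : (g * sing z c) x = g (x * z^-1)%g * c.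
Proof. exact: smul_singr. Qed.

Lemma scoefM_neq0 f g z : (f * g) z != 0 -> exists x, f x != 0 /\ g (x^-1 * z)%g != 0.
Proof. exact: conv_coef_neq0. Qed.

Definition grp z : D := sing z 1.

Lemma coef_grp z x : grp z x = (x == z)%:R.
Proof. by rewrite coef_sing; case: eqP. Qed.

Lemma grp1 : grp 1%g = 1. Proof. by []. Qed.

Lemma grplM z g x : (grp z * g) x = g (z^-1 * x)%g.
Proof. by rewrite singlM mul1r. Qed.

Lemma grprM z g x : (g * grp z) x = g (x * z^-1)%g.
Proof. by rewrite singrM mulr1. Qed.

Lemma grpM y z : grp (y * z)%g = grp y * grp z.
Proof.
apply: seriesP => x; rewrite grplM !coef_grp.
by rewrite -[x in LHS](mulVKg y) (inj_eq (mulgI _)).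
Qed.

Lemma grp_inj y z : grp y = grp z -> y = z.
Proof.
move/(congr1 (fun f : D => f y)); rewrite !coef_grp eqxx.
by case: eqP => // _ /eqP; rewrite oner_eq0.
Qed.

Section Restriction.
Variable P : set F.

Lemma restr_wo f : wo o [set x | (if `[< P x >] then f x else 0) != 0].
Proof. by apply: wo_sub (coef_wo f) => x /=; case: ifP => //; rewrite eqxx. Qed.

Arguments restr_wo f : clear implicits.

(** Used with a subgroup, as the projection onto D_G, and with an initial segment, as a
    truncation. *)
Definition restr f : D := Series (restr_wo f).

Lemma restrE f x : P x -> restr f x = f x.
Proof. by move=> Px /=; rewrite asboolT. Qed.

Lemma restr0 f x : ~ P x -> restr f x = 0.
Proof. by move=> Px /=; rewrite asboolF. Qed.

End Restriction.

(* [supported G f] says that f lies in the subring D_G of series on G. *)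
Definition supported G f := forall x, f x != 0 -> G x.

Lemma supportedI G (G' : set F) f : supported G f -> supported G' f -> supported (G `&` G') f.
Proof. by move=> h h' x fx; split; [apply: h|apply: h']. Qed.

Lemma supported0 G : supported G 0.
Proof. by move=> x; rewrite scoef0 eqxx. Qed.

Lemma supportedD G f g : supported G f -> supported G g -> supported G (f + g).
Proof.
move=> hf hg x; rewrite scoefD; have [->|/hf//] := eqVneq (f x) 0.
by rewrite add0r => /hg.
Qed.

Lemma supportedN G f : supported G f -> supported G (- f).
Proof. by move=> hf x; rewrite scoefN oppr_eq0 => /hf. Qed.

Lemma supported_sing G z c : G z -> supported G (sing z c).
Proof. by move=> Gz x; rewrite coef_sing; have [->|_ /eqP] := eqVneq x z. Qed.

Lemma supportedM G f g : subgroup G -> supported G f -> supported G g -> supported G (f * g).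
Proof.
move=> sG hf hg z /scoefM_neq0[x [/hf Gx /hg Gxz]].
by rewrite -(mulVKg x z); apply: subgroupM.
Qed.

Lemma supported1 G : subgroup G -> supported G 1.
Proof. by move=> /subgroup1; apply: supported_sing. Qed.

Lemma restr_supported G f : supported G (restr G f).
Proof. by move=> x; apply: contra_neqP => Gx; rewrite restr0. Qed.

Lemma restr_id G f : supported G f -> restr G f = f.
Proof.
move=> sf; apply: seriesP => x; have [Gx|Gx] := pselect (G x); first by rewrite restrE.
by rewrite restr0 //; apply/esym/eqP; apply: contra_notT Gx => /sf.
Qed.

(** For x and z in [G] the element x^-1 z is in [G], so the product at z sees only the part of [g]
    on [G]; outside [G] both sides vanish. *)
Lemma restrM G f g : subgroup G -> supported G f -> restr G (f * g) = f * restr G g.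
Proof.
move=> sG sf; apply: seriesP => z; have [Gz|Gz] := pselect (G z); last first.
  rewrite restr0 //; apply/esym/eqP; apply: contra_notT Gz.
  by apply: supportedM => //; apply: restr_supported.
rewrite restrE // !scoefM; apply: eq_fsbigr => x _.
have [->|/sf Gx] := eqVneq (f x) 0; first by rewrite !mul0r.
by rewrite restrE //; apply: subgroupM => //; apply: subgroupV.
Qed.

Lemma restrD G f g : restr G (f + g) = restr G f + restr G g.
Proof.
apply: seriesP => x; rewrite scoefD; have [Gx|Gx] := pselect (G x).
  by rewrite !restrE.
by rewrite !restr0 // addr0.
Qed.

Definition vanish_lt z f := forall x, o x z -> f x = 0.

Lemma series_lead f : f <> 0 -> exists2 m, f m != 0 & vanish_lt m f.
Proof.
move=> f0; have [//||m fm lm] := coef_wo f [set x | f x != 0].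
  apply: contrapT => h; apply: f0; apply: seriesP => x; apply/eqP.
  by apply: contra_notT h => fx; exists x.
by exists m => // x xm; apply/eqP; apply: contraPT xm; apply: lm.
Qed.

(** * Inverses of nonzero series *)

Section Inverse.
Variable a : D.
Hypothesis a1 : a 1%g = 1.
Hypothesis a_lt1 : vanish_lt 1%g a.

Lemma lead_mul f z : vanish_lt z f -> (a * f) z = f z.
Proof.
move=> fz; rewrite scoefM (@fsum_widen _ [set 1%g]).
  by rewrite fsbig_set1 a1 mul1r invg1 mul1g.
move=> x; rewrite mulf_eq0 negb_or => /andP[ax fx] /=.
have [x1|//|x1] := bi_total o x 1%g; first by rewrite a_lt1 ?eqxx in ax.
rewrite fz ?eqxx // in fx; rewrite -{2}[z]mul1g; apply: bi_mulr.
by rewrite -(mulVg x) -{1}[x^-1%g]mulg1; apply: bi_mull.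
Qed.

Lemma mul_agree f g z : (forall x, ~ o z x -> f x = g x) ->
  forall x, ~ o z x -> (a * f) x = (a * g) x.
Proof.
move=> fg x zx; apply/eqP; rewrite -subr_eq0 -scoefB -mulrBr lead_mul.
  by rewrite scoefB fg ?subrr.
move=> u ux; rewrite scoefB fg ?subrr // => zu.
by apply: zx; apply: bi_trans zu ux.
Qed.

Variable y : D.

(* Approximate solutions of [a * f = y], exact up to and including z; they
   are unique, so they can be glued. *)
Definition approx z f :=
  (forall x, o z x -> f x = 0) /\ (forall x, ~ o z x -> (a * f) x = y x).

Lemma approx_agree z z' f g x :
  approx z f -> approx z' g -> ~ o z x -> ~ o z' x -> f x = g x.
Proof.
move=> [_ fz] [_ gz'] zx z'x; have [/(congr1 (fun h : D => h x))|nfg] := pselect (f - g = 0).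
  by rewrite scoefB scoef0 => /eqP; rewrite subr_eq0 => /eqP.
have [m fgm lm] := series_lead nfg.
have [mx|xm] := pselect (o x m).
  by apply/eqP; rewrite -subr_eq0 -scoefB lm.
have zm : ~ o z m by move=> zm; apply: zx; apply: bi_lt_le zm xm.
have z'm : ~ o z' m by move=> z'm; apply: z'x; apply: bi_lt_le z'm xm.
case/eqP: fgm; rewrite -lead_mul // mulrBr scoefB fz // gz' //.
exact: subrr.
Qed.

Lemma approx_restr z z' f : approx z f -> o z' z -> approx z' (restr (fun x => ~ o z' x) f).
Proof.
move=> [f0 fy] z'z; split=> [x z'x|x z'x]; first by rewrite restr0.
rewrite -fy; last by move=> zx; apply: z'x; apply: bi_trans z'z zx.
by apply: (mul_agree (z := z')) => // u z'u; rewrite restrE.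
Qed.

(** This takes the place of the geometric series in 1 - a, whose convergence rests on Neumann's
    theorem about the semigroup generated by a well-ordered set: approximate solutions are glued,
    and a first error could be corrected by one more term. *)
Lemma solution : exists f, a * f = y.
Proof.
pose good z := exists f, approx z f.
pose X z := xget (0 : D) (approx z).
have XP z : good z -> approx z (X z).
  by move=> [f hf]; rewrite /X; case: xgetP => [_ -> //|/(_ f)].
have good_down z z' : good z -> o z' z -> good z'.
  by move=> [f hf] z'z; exists (restr (fun x => ~ o z' x) f); apply: approx_restr hf z'z.
(* The diagonal: by uniqueness it agrees with [X z] up to every good [z]. *)
pose c x := if `[< good x >] then X x x else 0.
have cE z x : good z -> ~ o z x -> c x = X z x.
  move=> gz zx; have gx : good x.
    by have [xz|->//|//] := bi_total o x z; apply: good_down xz.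
  by rewrite /c asboolT //; apply: (approx_agree (XP _ gx) (XP _ gz)) => //; apply: bi_irr.
have c0 x : ~ good x -> c x = 0 by move=> ngx; rewrite /c asboolF.
have c_wo : wo o [set x | c x != 0].
  move=> A Ac [z Az]; have gz : good z.
    by apply: contrapT => /c0 e; have /eqP := Ac _ Az.
  have [||m [Am zm] lm] := coef_wo (X z) (A `&` (fun x => ~ o z x)).
  - by move=> x [/Ac /= cx zx]; rewrite -(cE z).
  - by exists z; split=> //; apply: bi_irr.
  exists m => // x Ax xm; apply: (lm x) => //; split=> // zx.
  by apply: zm; apply: bi_trans zx xm.
pose f : D := Series c_wo.
have afE z : good z -> (a * f) z = y z.
  move=> gz; have [_ e] := XP _ gz; rewrite -e; last exact: bi_irr.
  by apply: (mul_agree (z := z)); [move=> x; apply: cE|apply: bi_irr].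
have [e|ne] := pselect (y - a * f = 0).
  by exists f; apply/esym/eqP; rewrite -subr_eq0 e.
have [v dv lv] := series_lead ne.
have ngv : ~ good v by move=> gv; case/eqP: dv; rewrite scoefB afE // subrr.
(* A single term at [v] repairs the error [d] and leaves the smaller coefficients of [a * f] alone,
   so [v] is good after all. *)
exfalso; apply: (ngv); pose d := (y - a * f) v; exists (f + sing v d).
have vs : vanish_lt v (sing v d).
  by move=> x; rewrite coef_sing; case: eqP => // -> /bi_irr.
split=> [x vx|x vx].
  rewrite scoefD coef_sing /= c0 ?add0r; last first.
    by move=> gx; apply: ngv; apply: good_down gx vx.
  by case: eqP => // e; case: (@bi_irr _ o v); rewrite -{2}e.
rewrite mulrDr scoefD [(a * sing _ _) x]lead_mul; last first.
  by move=> u ux; apply: vs; apply: bi_lt_le ux vx.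
have [xv|->|//] := bi_total o x v.
  by rewrite vs // addr0; have /eqP := lv x xv; rewrite scoefB subr_eq0 => /eqP.
by rewrite coef_sing eqxx /d scoefB addrC subrK.
Qed.

End Inverse.

Lemma series_rinv f : f <> 0 -> exists g, f * g = 1.
Proof.
move=> /series_lead[m fm lm].
(* Dividing by the leading term moves it to the group element 1 with coefficient 1, as [solution]
   requires. *)
have [||g eg] := @solution (sing m^-1%g (f m)^-1 * f) _ _ (1 : D).
- by rewrite singlM invgK mulg1 mulVf.
- move=> x x1; rewrite singlM invgK (lm (m * x)%g) ?mulr0 //.
  by have := bi_mull m x1; rewrite mulg1.
exists (g * sing m^-1%g (f m)^-1).
have inv : sing m (f m) * sing m^-1%g (f m)^-1 = 1.
  apply: seriesP => x; rewrite singlM coef_sing scoef1.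
  rewrite -[x in RHS](mulVKg m) -(mulgV m) (inj_eq (mulgI _)).
  by case: eqP => _; rewrite ?mulr0 ?mulfV.
by rewrite mulrA -[f * g]mul1r -inv -[_ * _ * (f * g)]mulrA [_ * (f * g)]mulrA eg mulr1 inv.
Qed.

Lemma series_inv f : f <> 0 -> exists g, f * g = 1 /\ g * f = 1.
Proof.
move=> f0; have [g fg] := series_rinv f0; exists g; split=> //.
have [|h gh] := @series_rinv g.
  by move=> g0; move: fg; rewrite g0 mulr0 => /esym/eqP; rewrite oner_eq0.
by rewrite -[f]mulr1 -{1}gh (mulrA f) fg mul1r.
Qed.

Lemma series_mulf_eq0 f g : f * g = 0 -> f <> 0 -> g = 0.
Proof. by move=> fg0 /series_inv[h [_ hf]]; rewrite -[g]mul1r -hf -mulrA fg0 mulr0. Qed.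

(* Restricting to G is left D_G-linear, so the inverse stays in D_G. *)
Lemma supported_inv G f g : subgroup G -> supported G f -> f * g = 1 -> supported G g.
Proof.
move=> sG sf fg; have f0 : f <> 0.
  by move=> f0; move: fg; rewrite f0 mul0r => /esym/eqP; rewrite oner_eq0.
have [h [_ hf]] := series_inv f0.
have e : f * restr G g = 1 by rewrite -restrM // fg restr_id //; apply: supported1.
have -> : g = restr G g by rewrite -[g in LHS]mul1r -hf -mulrA fg -e mulrA hf mul1r.
exact: restr_supported.
Qed.

End Series.

(** * Linear algebra over the series and Fox derivatives *)

Section Elimination.
Context {F : groupType} {o : biorder F}.
Local Notation D := (series o).
Local Open Scope ring_scope.

Lemma supported_sum (G : set F) (I : finType) (f : I -> D) :
  (forall i, supported G (f i)) -> supported G (\sum_i f i).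
Proof.
by move=> h; elim/big_ind: _ => [|f1 f2 h1 h2|i _];
  [exact: supported0|exact: supportedD|exact: h].
Qed.

(* Gaussian elimination inside the division ring D_G. *)
Lemma dependent_rows (G : set F) k n (A : 'I_n -> 'I_k -> D) : subgroup G -> (k < n)%N ->
  (forall i j, supported G (A i j)) ->
  exists c : 'I_n -> D, [/\ exists i, c i <> 0, forall i, supported G (c i)
    & forall j, \sum_i c i * A i j = 0].
Proof.
move=> sG; elim: k n A => [|k IH] n A kn sA.
  exists (fun=> 1); split=> [|i|[]//]; last exact: supported1.
  by exists (Ordinal kn); apply/eqP; rewrite oner_eq0.
have [[i0 p]|z] := pselect (exists i, A i ord0 <> 0); last first.
  have [||c [c0 sc cA]] := IH n (fun i j => A i (lift ord0 j)) => //; first exact: ltnW.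
  exists c; split=> // j; have [j' ->|->] := unliftP ord0 j; first exact: cA.
  rewrite big1 // => i _; have [->|nz] := pselect (A i ord0 = 0); first by rewrite mulr0.
  by case: z; exists i.
case: n A kn sA i0 p => [|n] A kn sA i0 p; first by case: i0 p.
have [g [pg gp]] := series_inv p.
have sg : supported G g by apply: supported_inv pg.
pose E i j := A (lift i0 i) (lift ord0 j) - A (lift i0 i) ord0 * g * A i0 (lift ord0 j).
have [||c [[i1 c1] sc cE]] := IH n E => //.
  move=> i j; apply: supportedD => //; apply: supportedN.
  by do 2?[apply: supportedM => //].
pose s := \sum_i c i * A (lift i0 i) ord0.
exists (fun i => if unlift i0 i is Some i' then c i' else - (s * g)); split=> [|i|j].
- by exists (lift i0 i1); rewrite liftK.
- case: unliftP => [i' _|_] //; apply: supportedN; apply: supportedM => //.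
  by apply: supported_sum => i'; apply: supportedM.
rewrite (bigD1_ord i0) //= unlift_none; under eq_bigr do rewrite liftK.
have [j' ->|->] := unliftP ord0 j; last first.
  by rewrite mulNr -mulrA gp mulr1 addNr.
have := cE j'; rewrite /E /=; under eq_bigr do rewrite mulrBr.
rewrite sumrB => /eqP; rewrite subr_eq0 => /eqP ->.
by rewrite mulNr /s !mulr_suml -sumrN -big_split big1 //= => i _; rewrite !mulrA addNr.
Qed.

End Elimination.

(** * Fox derivatives *)

Section Fox.
Context {F : groupType} {o : biorder F}.
Variables (J X : set F).
Hypothesis fX : free_basis J X.
Local Notation D := (series o).
Local Open Scope ring_scope.
Implicit Types (x y g h : F).

Definition fox_letter y (a : F * bool) : D :=
  if a.2 then - (grp a.1^-1%g * (a.1 == y)%:R) else (a.1 == y)%:R.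

(** The rule d(ag) = da + a dg, with [v] the derivative of the remaining word. *)
Definition fox_step y (a : F * bool) (v : D) : D := fox_letter y a + grp (letter a) * v.

Definition fox_word y (w : word F) : D := foldr (fox_step y) 0 w.

Definition fox y g : D := fox_word y (word_of X g).

Lemma fox_stepK y a v : fox_step y a (fox_step y (inv_letter a) v) = v.
Proof.
case: a => x [] /=; rewrite /fox_step /fox_letter /letter /= mulrDr mulrA -grpM ?mulVg ?mulgV grp1 mul1r.
  by rewrite addrA addNr add0r.
by rewrite mulrN mulrA -grpM mulgV grp1 mul1r addrA subrr add0r.
Qed.

Lemma fox_word_cat y (u v : word F) :
  fox_word y (u ++ v) = fox_word y u + grp (word_value u) * fox_word y v.
Proof.
elim: u => [|a u IH] /=; first by rewrite word_value_nil grp1 mul1r add0r.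
rewrite {1}/fox_word /= -/(fox_word y (u ++ v)) IH /fox_step mulrDr addrA.
by rewrite word_value_cons grpM mulrA.
Qed.

Lemma foxE y (w : word F) : word_over X w -> fox y (word_value w) = fox_word y w.
Proof.
move=> ow; have Jw : J (word_value w).
  exact: word_value_in (free_basis_subgroup fX) (free_basis_sub fX) ow.
have [ov ev] := word_ofP fX Jw.
by apply: (foldr_word_value _ fX) => // a v _; apply: fox_stepK.
Qed.

Let sJ := free_basis_subgroup fX.

Lemma foxM y g h : J g -> J h -> fox y (g * h)%g = fox y g + grp g * fox y h.
Proof.
move=> Jg Jh; have [og eg] := word_ofP fX Jg; have [oh eh] := word_ofP fX Jh.
rewrite -{1}eg -{1}eh -word_value_cat foxE; last exact/word_over_cat.
by rewrite fox_word_cat eg.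
Qed.

Lemma fox1 y : fox y 1%g = 0.
Proof. by rewrite -word_value_nil foxE. Qed.

Lemma foxV y g : J g -> fox y g^-1%g = - (grp g^-1%g * fox y g).
Proof.
move=> Jg; have := foxM y (subgroupV sJ Jg) Jg; rewrite mulVg fox1.
by move/esym/eqP; rewrite addr_eq0 => /eqP.
Qed.

Lemma fox_basis y x : X x -> fox y x = (x == y)%:R.
Proof.
move=> Xx; have -> : x = word_value [:: (x, false)].
  by rewrite word_value_cons word_value_nil mulg1.
rewrite foxE; last exact/word_over_cons.
by rewrite /fox_word /= /fox_step /fox_letter /= mulr0 addr0 word_value_cons word_value_nil mulg1.
Qed.

(** The chain rule, by induction on a word in the generators. Keeping the coefficients inside the
    series on the subgroup is what later places them in D_H and in D_K. *)
Lemma fox_generated k (a : 'I_k -> F) g : (forall i, J (a i)) -> generated (range a) g ->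
  exists P : 'I_k -> D, (forall i, supported (generated (range a)) (P i)) /\
    forall y, fox y g = \sum_i P i * fox y (a i).
Proof.
move=> Ja /generatedE[w ow <-] {g}; have sG := generated_subgroup (range a).
have Ga i : generated (range a) (a i) by apply: sub_generated; exists i.
elim: w ow => [|[x b] w IH] ow.
  exists (fun=> 0); split=> [i|y]; first exact: supported0.
  by rewrite word_value_nil fox1 big1 // => i _; rewrite mul0r.
have [[i0 _ /= e]] := (word_over_cons (range a) (x, b) w).1 ow.
move=> /[dup] ow' /IH[P [sP fP]].
have JG : generated (range a) `<=` J by apply: generated_sub => // _ [i _ <-].
have Jw : J (word_value w).
  by apply: JG; apply: word_value_in sG _ ow'; apply: sub_generated.
have Gx : generated (range a) (letter (x, b)).
  by rewrite /letter /= -e; rewrite e; case: b {ow} => /=; rewrite -e; [exact: (subgroupV sG)|].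
pose c : D := if b then - grp x^-1%g else 1.
have sc : supported (generated (range a)) c.
  rewrite /c; case: (b); last exact: supported1.
  by apply: supportedN; apply: supported_sing; apply: (subgroupV sG); rewrite -e.
exists (fun i => (if i == i0 then c else 0) + grp (letter (x, b)) * P i); split=> [i|y].
  apply: supportedD; first by case: ifP => // _; apply: supported0.
  by apply: supportedM => //; apply: supported_sing.
rewrite word_value_cons foxM //; last exact: JG.
under eq_bigr do rewrite mulrDl -mulrA.
rewrite big_split /= -mulr_sumr -fP; congr (_ + _).
rewrite (bigD1 i0) //= eqxx big1 ?addr0; last by move=> i /negbTE ->; rewrite mul0r.
rewrite e /c /letter /=; case: (b); last by rewrite mul1r.
by rewrite foxV ?mulNr // -e.
Qed.

(** The fundamental formula of Fox calculus. Its right-hand side lies in D_L when g is in L,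
    although the derivatives are taken in the larger group. *)
Lemma fox_boundary n (x : 'I_n -> F) g : range x = X -> injective x -> J g ->
  \sum_i fox (x i) g * (grp (x i) - 1) = grp g - 1.
Proof.
move=> rx ix Jg; have [ow <-] := word_ofP fX Jg; elim: (word_of X g) ow {Jg} => [|a w IH] ow.
  by rewrite word_value_nil grp1 subrr big1 // => i _; rewrite fox1 mul0r.
have [Xa ow'] := (word_over_cons X a w).1 ow.
have JX := free_basis_sub fX.
have Ja : J (letter a) by rewrite /letter; case: a.2; [apply: subgroupV sJ _|]; apply: JX.
have Jw : J (word_value w) by apply: word_value_in ow'.
rewrite word_value_cons; under eq_bigr do rewrite foxM // mulrDl -mulrA.
rewrite big_split /= -mulr_sumr (IH ow') mulrBr -grpM mulr1.
suff -> : \sum_i fox (x i) (letter a) * (grp (x i) - 1) = grp (letter a) - 1.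
  by rewrite addrC addrA subrK.
have key y : X y -> \sum_i fox (x i) y * (grp (x i) - 1) = grp y - 1.
  rewrite -rx => -[i0 _ <-]; rewrite (bigD1 i0) //= fox_basis; last by rewrite -rx; exists i0.
  rewrite eqxx mul1r big1 ?addr0 // => i ii0; rewrite fox_basis; last by rewrite -rx; exists i0.
  by rewrite (inj_eq ix) eq_sym (negbTE ii0) mul0r.
rewrite /letter; case: a.2; last exact: key.
under eq_bigr do (rewrite foxV ?mulNr -?mulrA; last exact: JX).
by rewrite sumrN -mulr_sumr key // mulrBr -grpM mulVg mulr1 opprB.
Qed.

End Fox.

(** * Schreier bases *)

Section Schreier.
Context {F : groupType} {o : biorder F}.
Variables (J X L : set F).
Hypothesis fX : free_basis J X.
Hypothesis sL : subgroup L.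
Hypothesis LJ : L `<=` J.
Local Notation D := (series o).
Implicit Types (T B : set F) (x y t g b : F) (w u v : word F).
Let sJ := free_basis_subgroup fX.
Let XJ := free_basis_sub fX.

Definition path_in T w := forall k, T (word_value (take k w)).

(** A tree in the coset graph of [L], lifted to [J]: distinct elements represent distinct cosets
    [L t], and each is reached from 1 by a path inside [T]. *)
Definition partial_transversal T :=
  (forall t t', T t -> T t' -> L (t / t') -> t = t') /\
  (forall t, T t -> exists w, [/\ word_over X w, word_value w = t & path_in T w]).

Lemma path_in_sub T T' w : T `<=` T' -> path_in T w -> path_in T' w.
Proof. by move=> TT' pw k; apply: TT'. Qed.

Lemma schreier_transversal : exists T,
  [/\ partial_transversal T, T 1 & forall g, J g -> exists2 t, T t & L (g / t)].
Proof.
have [C PC totC|T [[iT pT] maxT]] := @Zorn_bigcup F partial_transversal.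
  split=> [t t' [A CA At] [A' CA' A't']|t [A CA At]].
    have [AA'|A'A] := totC _ _ CA CA'.
      by apply: (PC _ CA').1 => //; apply: AA'.
    by apply: (PC _ CA).1 => //; apply: A'A.
  have [w [ow vw pw]] := (PC _ CA).2 t At; exists w; split=> //.
  by apply: path_in_sub pw => s As; exists A.
have extend t0 w : word_over X w -> word_value w = t0 ->
    (forall k, T (word_value (take k w)) \/ word_value (take k w) = t0) ->
    (forall t, T t -> ~ L (t0 / t)) -> T t0.
  move=> ow vw pw nt0.
  have PT : partial_transversal (T `|` [set t0]).
    split=> [t t' [Tt|->] [Tt'|->] //|t [Tt|->]].
    - exact: iT.
    - by move=> l; case: (nt0 t Tt); rewrite -invgF; apply: (subgroupV sL).
    - by move=> l; case: (nt0 t' Tt').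
    - have [w' [ow' vw' pw']] := pT t Tt; exists w'; split=> //.
      by apply: path_in_sub pw'; left.
    - by exists w; split.
    apply: contrapT => nTt; apply: (maxT _ _ PT); split=> [t|sub]; first by left.
  by apply: nTt; apply: sub; right.
have T1 : T 1.
  (* The maximal family could a priori be empty, and then 1 can be added; otherwise any path in [T]
     starts at 1. *)
  apply: contrapT => nT1; apply: (nT1).
  have [e|/set0P[t Tt]] := eqVneq T set0.
    apply: (extend 1 [::]) => [|//|k|t]; rewrite ?word_value_nil ?e //.
    by right.
  have [w [_ _ pw]] := pT t Tt; have := pw 0; by rewrite take0 word_value_nil.
exists T; split=> // g Jg; have [ow <-] := word_ofP fX Jg.
elim/last_ind: (word_of X g) ow => [|w a IH].
  by exists 1 => //; rewrite divg1 word_value_nil; apply: subgroup1.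
rewrite -cats1 => /word_over_cat[/IH[t Tt Lt] oa].
apply: contrapT => h.
have la : word_value [:: a] = letter a by rewrite word_value_cons word_value_nil mulg1.
(* The coset to be reached contains [t * letter a]; were it not represented, this element could be
   added at the end of the path to [t], against maximality. *)
have Lta : L (word_value (w ++ [:: a]) / (t * letter a)).
  by rewrite word_value_cat la mulgKA.
apply: (h); exists (t * letter a) => //.
have [w' [ow' vw' pw']] := pT t Tt.
apply: (extend _ (w' ++ [:: a])).
- exact/word_over_cat.
- by rewrite word_value_cat vw' la.
- move=> k; rewrite take_cat; case: ltnP => [_|]; first by left; apply: pw'.
  case: (k - size w')%N => [|n _] /=; first by rewrite cats0 vw'; left.
  by right; rewrite word_value_cat vw' -la.
- move=> t' Tt' Lt'; apply: h; exists t' => //.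
  by have := subgroupM sL Lta Lt'; rewrite divgKA.
Qed.

(** * Schreier generators of a transversal *)

Section Transversal.
Variable T : set F.
Hypothesis PT : partial_transversal T.
Hypothesis T1 : T 1.
Hypothesis coverT : forall g, J g -> exists2 t, T t & L (g / t).

Let iT : forall t t', T t -> T t' -> L (t / t') -> t = t' := PT.1.

Lemma transversal_sub : T `<=` J.
Proof. by move=> t /(PT.2)[w [ow <- _]]; apply: word_value_in ow. Qed.

Definition rep g := xget 1 [set t | T t /\ L (g / t)].

Lemma repP g : J g -> T (rep g) /\ L (g / rep g).
Proof. by move=> /coverT[t Tt Lt]; rewrite /rep; case: xgetP => [_ -> //|/(_ t)]; case. Qed.

Lemma rep_uniq g t : J g -> T t -> L (g / t) -> rep g = t.
Proof.
move=> Jg Tt Lt; have [Tr Lr] := repP Jg; apply: iT => //.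
rewrite -(divgKA g); apply: (subgroupM sL) => //.
by rewrite -invgF; apply: (subgroupV sL).
Qed.

Lemma rep_id t : T t -> rep t = t.
Proof.
by move=> Tt; apply: rep_uniq => //; [apply: transversal_sub|rewrite mulgV; apply: subgroup1].
Qed.

(** One generator for each edge leaving [T]; an edge with both ends in [T] would give 1. *)
Definition schreier_gens : set F :=
  [set b | exists t x, [/\ T t, X x, ~ T (t * x) & b = t * x / rep (t * x)]].

Lemma schreier_gens_sub : schreier_gens `<=` L.
Proof.
move=> _ [t [x [Tt Xx _ ->]]].
by apply: (repP _).2; apply: (subgroupM sJ); [apply: transversal_sub|apply: XJ].
Qed.

Lemma schreier_gens_edge t x : T t -> X x ->
  generated schreier_gens (t * x / rep (t * x)).
Proof.
move=> Tt Xx; have [Ttx|nT] := pselect (T (t * x)).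
  by rewrite rep_id // mulgV; apply: subgroup1; apply: generated_subgroup.
by apply: sub_generated; exists t, x.
Qed.

(** Along a word read from t in [T], the factors t a / rep (t a) telescope; an inverse letter gives
    the inverse of the factor of the same edge read forwards. *)
Lemma schreier_gens_generate : generated schreier_gens = L.
Proof.
apply/seteqP; split; first exact: generated_sub schreier_gens_sub.
have sB := generated_subgroup schreier_gens.
move=> l Ll; have [ow vw] := word_ofP fX (LJ Ll).
suff key w t : word_over X w -> T t ->
    generated schreier_gens (t * word_value w / rep (t * word_value w)).
  have := key _ _ ow T1; rewrite vw mul1g (rep_uniq (LJ Ll) T1) ?divg1 //.
elim: w t => [|a w IH] t.
  by rewrite word_value_nil mulg1 => _ Tt; rewrite rep_id // mulgV; apply: subgroup1.
move=> /word_over_cons[Xa ow'] Tt; rewrite word_value_cons.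
have Jt := transversal_sub Tt.
have Jw : J (word_value w) by apply: word_value_in ow'.
have Ja : J (letter a) by rewrite /letter; case: a.2; [apply: (subgroupV sJ)|]; apply: XJ.
have Jta := subgroupM sJ Jt Ja.
have [Tr Lr] := repP Jta; set r := rep _ in Tr Lr.
have ga : generated schreier_gens (t * letter a / r).
  move: Lr; rewrite /r /letter; case: a.2 => [|_]; last exact: schreier_gens_edge.
  set r' := rep _ => Lr; have [Tr' Lr'] : T r' /\ L (t / a.1 / r').
    by apply: repP; apply: (subgroupM sJ) => //; apply: (subgroupV sJ); apply: XJ.
  have Jr' : J (r' * a.1) by apply: (subgroupM sJ); [apply: transversal_sub|apply: XJ].
  have e : rep (r' * a.1) = t.
    apply: rep_uniq => //; have := subgroupV sL Lr'.
    by rewrite invgF invgM invgK mulgA.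
  have := subgroupV sB (schreier_gens_edge Tr' Xa); rewrite e.
  by rewrite invgF invgM mulgA.
have e : rep (r * word_value w) = rep (t * (letter a * word_value w)).
  have Jrw : J (r * word_value w) by apply: (subgroupM sJ) => //; apply: transversal_sub.
  have Jtw : J (t * (letter a * word_value w)) by rewrite mulgA; apply: (subgroupM sJ).
  apply: rep_uniq => //; first by case: (repP Jtw).
  have [_ Lq] := repP Jtw; rewrite -(divgKA (t * (letter a * word_value w))).
  apply: (subgroupM sL) => //; rewrite mulgA mulgKA -invgF.
  exact: (subgroupV sL).
have := subgroupM sB ga (IH _ ow' Tr); rewrite e.
by rewrite -mulgA [r^-1 * _]mulgA mulKg !mulgA.
Qed.

Local Open Scope ring_scope.

(* The path from 1 to a representative only crosses edges inside T. *)
Lemma fox_transversal y t g : T t -> (fox (o := o) X y t) g != 0 -> T g /\ T (g * y)%g.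
Proof.
move=> /(PT.2)[w [ow <- pw]]; rewrite (foxE fX) //.
elim/last_ind: w ow pw => [|w a IH].
  by [].
rewrite -cats1 => /word_over_cat[ow oa] pw.
have pw' : path_in T w.
  move=> k; have [kw|kw] := leqP k (size w); first by have := pw k; rewrite takel_cat.
  by have := pw (size w); rewrite takel_cat // take_size take_oversize // ltnW.
have Tw : T (word_value w) by have := pw' (size w); rewrite take_size.
have Twa : T (word_value w * letter a)%g.
  have := pw (size w).+1; rewrite take_oversize ?size_cat ?addn1 // word_value_cat.
  by rewrite word_value_cons word_value_nil mulg1.
rewrite fox_word_cat scoefD.
have [->|nz _] := eqVneq (fox_word (o := o) y w g) 0; last exact: (IH ow pw' nz).
have ea : fox_word (o := o) y [:: a] = fox_letter y a.
  by rewrite -[LHS]/(fox_step y a 0) /fox_step mulr0 addr0.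
rewrite add0r grplM ea.
move: Twa; rewrite /letter /fox_letter; case: a {oa pw ea} => x [] Twa; rewrite [(_, _).1]/= [(_, _).2]/= in Twa *.
  have [exy|_] := eqVneq x y; last by rewrite mulr0 oppr0 scoef0 eqxx.
  rewrite exy in Twa *.
  rewrite mulr1 scoefN oppr_eq0 coef_grp.
  have [e _|_ /eqP //] := eqVneq ((word_value w)^-1 * g)%g (y^-1)%g.
  have -> : g = (word_value w * y^-1)%g by rewrite -e mulVKg.
  by rewrite mulgVK.
have [exy|_] := eqVneq x y; last by rewrite scoef0 eqxx.
rewrite scoef1; have [e _|_ /eqP //] := eqVneq ((word_value w)^-1 * g)%g 1%g.
have -> : g = word_value w by rewrite -[LHS](mulVKg (word_value w)) e mulg1.
by rewrite -exy.
Qed.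

(** The derivative of t' x' / r splits into parts from t', x' and r. Up to translation by [L], the
    first and last live on edges inside [T], so they vanish on the coset [L t], because t x is
    outside [T]. The middle part lives at t' alone, which forces t' = t and x' = x. *)
Lemma fox_schreier_gens b t x b' : T t -> X x -> ~ T (t * x)%g ->
  b = (t * x / rep (t * x))%g -> schreier_gens b' ->
  restr L (fox (o := o) X x b' * grp t^-1%g) = (b' == b)%:R.
Proof.
move=> Tt Xx nT eb; have key s (u : F) : T s -> L u -> fox (o := o) X x s (u * t)%g = 0.
  move=> Ts Lu; apply/eqP; apply: contra_notT nT => /(fox_transversal Ts)[Tut].
  have -> // : (u * t)%g = t by apply: iT => //; rewrite mulgK.
have formula t' x' : T t' -> X x' -> forall u : F, L u ->
    fox (o := o) X x (t' * x' / rep (t' * x'))%g (u * t)%g =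
    (if (x' == x) && (u * t == t')%g then 1 else 0).
  move=> Tt' Xx' u Lu; have Jt' := transversal_sub Tt'; have Jx' := XJ Xx'.
  have Jtx := subgroupM sJ Jt' Jx'; have [Tr Lr] := repP Jtx.
  have Jr := transversal_sub Tr; have Jr' := subgroupV sJ Jr.
  rewrite (foxM fX) // (foxM fX) // (foxV fX) // (fox_basis fX _ Xx') mulrN.
  rewrite mulrA -grpM !scoefD scoefN !grplM key // add0r.
  have -> : ((t' * x' / rep (t' * x'))^-1 * (u * t) = ((t' * x' / rep (t' * x'))^-1 * u) * t)%g.
    by rewrite mulgA.
  rewrite key ?subr0 //; last by apply: (subgroupM sL) => //; apply: (subgroupV sL).
  case: (x' == x); last by rewrite scoef0.
  by rewrite scoef1 andTb -[1%g](mulVg t') (inj_eq (mulgI _)).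
have [-> _|bb' [t' [x' [Tt' Xx' _ eb']]]] := eqVneq b' b.
  rewrite eb; apply: seriesP => u; rewrite scoef1; have [Lu|Lu] := pselect (L u).
    rewrite restrE // grprM invgK formula // eqxx /= -[t in LHS]mul1g.
    rewrite mulgA mulg1 (inj_eq (mulIg _)) //.
  by rewrite restr0 //; case: eqP => // u1; case: Lu; rewrite u1; apply: subgroup1.
apply: seriesP => u; rewrite scoef0; have [Lu|Lu] := pselect (L u); last by rewrite restr0.
rewrite restrE // grprM invgK eb' formula //; case: ifP => // /andP[/eqP exx /eqP ett].
case/eqP: bb'; rewrite eb eb' exx -(iT Tt' Tt) //.
by rewrite -ett mulgK.
Qed.

End Transversal.

(** * Independence and freeness of separated sets *)

Local Open Scope ring_scope.

(* Some coefficient of some Fox derivative detects b among the elements of B,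
   D_L-linearly. *)
Definition separated B := forall b, B b -> exists x t, X x /\
  forall b', B b' -> restr L (fox (o := o) X x b' * grp t) = (b' == b)%:R.

(** The functional detecting [l i] is left D_L-linear, so it reduces the relation to [c i = 0]. *)
Lemma separated_independent B n (l : 'I_n -> F) (c : 'I_n -> D) :
  separated B -> injective l -> (forall i, B (l i)) -> (forall i, supported L (c i)) ->
  (forall x, X x -> \sum_i c i * fox X x (l i) = 0) -> forall i, c i = 0.
Proof.
move=> sB il Bl sc c0 i; have [x [t [Xx e]]] := sB _ (Bl i).
have := congr1 (fun d => restr L (d * grp t)) (c0 x Xx).
rewrite /= mul0r (restr_id (supported0 L)) mulr_suml => <-.
rewrite (big_morph _ (restrD L) (restr_id (supported0 L))) (bigD1 i) //= big1 ?addr0.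
  by rewrite -mulrA restrM // e // eqxx mulr1.
by move=> j ji; rewrite -mulrA restrM // e // (inj_eq il) (negbTE ji) mulr0.
Qed.

(** On [L] the detecting functional obeys the product rule of Fox derivatives, and it takes the
    values 1 at b and 0 elsewhere on [B]. So it is the derivative along b with respect to [B],
    computed on words since [B] is not yet known to be free. *)
Lemma separated_fox_word B b x t w : B `<=` L -> X x ->
  (forall b', B b' -> restr L (fox (o := o) X x b' * grp t) = (b' == b)%:R) ->
  word_over B w -> restr L (fox (o := o) X x (word_value w) * grp t) = fox_word b w.
Proof.
move=> BL Xx e; elim: w => [|a w IH].
  by move=> _; rewrite word_value_nil (fox1 fX) mul0r (restr_id (supported0 L)).
move=> /word_over_cons[Ba ow].
have La : L (letter a) by rewrite /letter; case: a.2; [apply: (subgroupV sL)|]; apply: BL.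
have Lw : L (word_value w) by apply: word_value_in ow.
rewrite word_value_cons (foxM fX) ?mulrDl ?restrD; [|exact: LJ|exact: LJ].
have sa : supported L (grp (o := o) (letter a)) := supported_sing La.
rewrite -[grp _ * _ * _]mulrA (restrM _ sL sa) IH //.
rewrite -[RHS]/(fox_step b a (fox_word b w)) /fox_step; congr (_ + _).
move: La; rewrite /letter /fox_letter; case: a.2 => La; last exact: e.
rewrite (foxV fX); last by apply: LJ; apply: BL.
have sV : supported L (grp (o := o) a.1^-1%g) := supported_sing La.
rewrite mulNr -mulrA -mulrN (restrM _ sL sV).
have -> : restr L (- (fox X x a.1 * grp t)) = - restr L (fox (o := o) X x a.1 * grp t).
  by apply: (@addrI _ (restr L (fox X x a.1 * grp t))); rewrite -restrD !subrr (restr_id (supported0 L)).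
by rewrite e // mulrN.
Qed.

(** In the Cayley graph: the path [w] crosses the edge from g to g b, forwards or, if e holds,
    backwards. *)
Lemma fox_word_neq0 b w g : (fox_word (o := o) b w) g != 0 ->
  exists u (e : bool) v, w = u ++ (b, e) :: v /\
    g = (word_value u * if e then b^-1 else 1)%g.
Proof.
elim: w g => [|[x e] w IH] g //.
rewrite -[fox_word _ _]/(fox_step b (x, e) (fox_word b w)) /fox_step scoefD.
have [->|nz _] := eqVneq (fox_letter (o := o) b (x, e) g) 0.
  rewrite add0r grplM => /IH[u [e' [v [-> eg]]]].
  exists ((x, e) :: u), e', v; split=> //.
  by rewrite word_value_cons -mulgA -eg mulVKg.
exists [::], e, w; rewrite word_value_nil mul1g; move: nz; rewrite /fox_letter.
rewrite [(_, _).1]/= [(_, _).2]/=; have [->|_] := eqVneq x b; last first.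
  by case: e; rewrite ?mulr0 ?oppr0 scoef0 eqxx.
case: e; rewrite ?scoefN ?oppr_eq0 ?mulr1 ?coef_grp ?scoef1 => h; split=> //.
  by move: h; have [->|_ /eqP] := eqVneq g b^-1%g.
by move: h; have [->|_ /eqP] := eqVneq g 1%g.
Qed.

(* A shortest nonempty reduced word of value 1 would be a simple closed path,
   crossing each edge at most once. *)
Lemma separated_free B w : B `<=` L -> separated B ->
  reduced w -> word_over B w -> w <> [::] -> word_value w <> 1%g.
Proof.
move=> BL sB; have [n] := ubnP (size w); elim: n w => // n IH [//|[b e] w] sw rw ow _ vw.
have [Bb ow'] := (word_over_cons B (b, e) w).1 ow.
have [x [t [Xx hb]]] := sB b Bb.
have := separated_fox_word BL Xx hb ow; rewrite vw (fox1 fX) mul0r (restr_id (supported0 L)).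
rewrite -[fox_word _ _]/(fox_step b (b, e) (fox_word b w)) /fox_step.
(* The initial vertex of the edge crossed by the first letter, in the orientation of b. *)
pose q : F := if e then b^-1%g else 1%g.
move/(congr1 (fun d : D => d q)); rewrite scoefD grplM scoef0.
have lq : (fox_letter (o := o) b (b, e)) q != 0.
  rewrite /fox_letter /q [(_, _).1]/= [(_, _).2]/= eqxx mulr1.
  by case: (e); rewrite ?scoefN ?oppr_eq0 ?coef_grp ?scoef1 eqxx.
have [->|] := eqVneq (fox_word (o := o) b w ((letter (b, e))^-1 * q)%g) 0.
  by rewrite addr0 => /esym/eqP; rewrite (negbTE lq).
(* The total derivative is 0, so the contribution of the first letter at [q] must cancel: the path
   crosses the same edge again, after a segment [u]. *)
move=> /fox_word_neq0[u [e' [v [ew eg]]]] _.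
rewrite ew in rw ow vw sw ow'.
have ru : reduced ((b, e) :: u) by move: rw; rewrite !reducedE /= cat_path => /andP[].
have [ou _] := (word_over_cat B u ((b, e') :: v)).1 ow'.
have su : (size u < n)%N.
  by move: sw; rewrite /= ltnS; apply: leq_ltn_trans; rewrite size_cat leq_addr.
have long : word_value ((b, e) :: u) <> 1%g.
  apply: IH => //; last exact/word_over_cons.
  by move: sw; rewrite /= ltnS size_cat /= addnS; apply: leq_ltn_trans; rewrite ltnS leq_addr.
have short : word_value u = 1%g -> e = e'.
  case: u ru rw ou su {ew eg long sw ow vw ow'} => [_ rw _ _ _|c u ru _ ou su vu].
    have /andP[] : path compatible (b, e) ((b, e') :: v) := rw.
    by rewrite /compatible /= eqxx /= negbK => /eqP.
  by case: (IH (c :: u)) => //; move: ru; rewrite !reducedE /= => /andP[].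
(* Same direction: (b, e) followed by u is a closed path, excluded by [long]. Opposite directions: u
   is closed, and [short] then makes the directions equal. *)
move: eg long short; rewrite word_value_cons /q /letter /=; case: (e); case: (e') => /=.
- by rewrite invgK mulgV => /esym/eqP; rewrite mulg_eq1 invgK => /eqP ->; rewrite mulVg.
- by rewrite invgK mulgV mulg1 => <- _ /(_ erefl).
- rewrite mulg1 -{1}[b^-1%g]mul1g => /mulIg <- _ /(_ erefl) //.
- by rewrite !mulg1 => <-; rewrite mulgV.
Qed.

End Schreier.

(** The Nielsen-Schreier theorem with separation added. It serves twice: for the join inside [F] and
    for the intersection inside the join. *)
Lemma schreier_basis (F : groupType) (o : biorder F) (J X L : set F) :
  free_basis J X -> subgroup L -> L `<=` J ->
  exists B, free_basis L B /\ separated (o := o) X L B.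
Proof.
move=> fX sL LJ; have [T [PT T1 cT]] := schreier_transversal fX sL.
exists (schreier_gens X L T).
have sB : separated (o := o) X L (schreier_gens X L T).
  move=> b [t [x [Tt Xx nT eb]]]; exists x, t^-1%g; split=> // b' Bb'.
  exact: (fox_schreier_gens fX sL PT cT Tt Xx nT eb Bb').
split=> //; split; first exact: (schreier_gens_generate fX sL LJ PT T1 cT).
move=> w; apply: (separated_free fX sL LJ _ sB).
exact: (schreier_gens_sub fX PT cT).
Qed.

(** * Ranks of intersections and joins *)

Lemma card_enum (T : Type) (A : set T) n : A #= `I_n ->
  exists x : 'I_n -> T, injective x /\ range x = A.
Proof.
rewrite card_eq_sym => /card_bijP[f [g fK gK]].
pose h (i : 'I_n) : `I_n := SigSub (mem_set (ltn_ord i : `I_n i)).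
exists (fun i => val (f (h i))); split=> [i j /val_inj /(can_inj fK) /(congr1 val) /= e|].
  exact: val_inj.
apply/seteqP; split=> [_ [i _ <-]|y Ay]; first exact: set_valP.
pose k := g (SigSub (mem_set Ay)); have kn : (val k < n)%N := set_valP k.
exists (Ordinal kn) => //; have -> : h (Ordinal kn) = k by apply: val_inj.
by rewrite gK.
Qed.

Lemma card_bounded (T : Type) (A : set T) k :
  (forall x : 'I_k.+1 -> T, injective x -> (forall i, A (x i)) -> False) ->
  exists2 n, (n <= k)%N & A #= `I_n.
Proof.
move=> h; have [[n An]|/infiniteP/card_leP[f]] := pselect (finite_set A).
  exists n => //; rewrite leqNgt; apply/negP => kn; have [x [ix rx]] := card_enum An.
  apply: (h (fun i => x (widen_ord kn i))) => [i j /ix /(congr1 val) /= e|i].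
    exact: val_inj.
  by rewrite -rx; exists (widen_ord kn i).
exfalso; pose m (i : nat) : [set: nat] := SigSub (mem_set (I : [set: nat] i)).
apply: (h (fun i => val (f (m i)))) => [i j /val_inj e|i]; last exact: set_valP.
have /(congr1 val) /= := @inj _ _ _ f (m i) (m j) (mem_set I) (mem_set I) e.
exact: val_inj.
Qed.

Section Intersection.
Context {F : groupType} {o : biorder F}.
Local Notation D := (series o).
Local Open Scope ring_scope.
Variables (J X : set F).
Hypothesis fX : free_basis J X.
Variables (p q : nat) (a : 'I_p -> F) (b : 'I_q -> F).
Let H := generated (range a).
Let K := generated (range b).
Hypothesis HJ : H `<=` J.
Hypothesis KJ : K `<=` J.
Hypothesis eJ : J = generated (H `|` K).
Let sJ : subgroup J := free_basis_subgroup fX.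
Let aH i : H (a i). Proof. by apply: sub_generated; exists i. Qed.
Let bK i : K (b i). Proof. by apply: sub_generated; exists i. Qed.

Local Notation fox y g := (@fox F o X y g).

Let e (i : 'I_(p + q)) : F := match fintype.split i with inl j => a j | inr j => b j end.

Let JE : J = generated (range e).
Proof.
have el i : e (lshift q i) = a i by rewrite /e (unsplitK (inl i)).
have er i : e (rshift p i) = b i by rewrite /e (unsplitK (inr i)).
apply/seteqP; split.
  rewrite {1}eJ; apply: generated_sub; first exact: generated_subgroup.
  move=> x [|]; apply: generated_sub; try exact: generated_subgroup.
    by move=> _ [i _ <-]; apply: sub_generated; exists (lshift q i).
  by move=> _ [i _ <-]; apply: sub_generated; exists (rshift p i).
apply: generated_sub => // _ [i _ <-]; rewrite /e.
by case: fintype.split => j; [apply: HJ|apply: KJ].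
Qed.

(* The Fox gradients of a and b span D^X; each independent family of
   gradients common to both spans lowers the dimension. *)
Lemma rank_bound n m (x : 'I_n -> F) (l : 'I_m -> F) :
  injective x -> (forall i, X (x i)) -> (forall i, H (l i)) -> (forall i, K (l i)) ->
  (forall c : 'I_m -> D, (forall y, X y -> \sum_i c i * fox y (l i) = 0) -> forall i, c i = 0) ->
  (n + m <= p + q)%N.
Proof.
move=> ix Xx Hl Kl li.
have XJ := free_basis_sub fX.
have /choice[A hA] j : exists A : 'I_(p + q) -> D,
    forall y, fox y (x j) = \sum_i A i * fox y (e i).
  have [||P [_ hP]] := @fox_generated F o J X fX _ e (x j); last by exists P.
    by move=> i; rewrite JE; apply: sub_generated; exists i.
  by rewrite -JE; apply: XJ.
have /choice[P hP] s : exists P : 'I_p -> D,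
    forall y, fox y (l s) = \sum_i P i * fox y (a i).
  have [|P [_ hP]] := @fox_generated F o J X fX _ a (l s) _ (Hl s); last by exists P.
  by move=> i; apply: HJ.
have /choice[Q hQ] s : exists Q : 'I_q -> D,
    forall y, fox y (l s) = \sum_i Q i * fox y (b i).
  have [|Q [_ hQ]] := @fox_generated F o J X fX _ b (l s) _ (Kl s); last by exists Q.
  by move=> i; apply: KJ.
(* The expansions of [l s] through [a] and through [b] differ by a relation between the gradients of
   [e]. *)
pose R s (i : 'I_(p + q)) : D := match fintype.split i with inl j => P s j | inr j => - Q s j end.
have R0 s y : \sum_i R s i * fox y (e i) = 0.
  rewrite big_split_ord /=.
  under eq_bigr do rewrite /R /e (unsplitK (inl _)).
  under [X in _ + X]eq_bigr do rewrite /R /e (unsplitK (inr _)) mulNr.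
  by rewrite sumrN -hP -hQ subrr.
rewrite leqNgt; apply/negP => lt.
(* The n expansions and the m relations are rows of length p + q; too many of them would be
   dependent. *)
pose M (k : 'I_(n + m)) := match fintype.split k with inl j => A j | inr s => R s end.
have [|c [[k0 nz] _ hc]] := dependent_rows (G := setT) (A := M) subgroupT lt; first by [].
pose c1 j := c (lshift m j); pose c2 s := c (rshift n s).
have rel i : \sum_j c1 j * A j i + \sum_s c2 s * R s i = 0.
  apply: etrans (hc i); rewrite big_split_ord /=; congr (_ + _); apply: eq_bigr => j _.
    by rewrite /M (unsplitK (inl j)).
  by rewrite /M (unsplitK (inr j)).
(* Pairing the dependency with the derivatives of [e] along [x j] kills the relations and leaves
   [c1 j]. *)
have c10 j : c1 j = 0.
  have : \sum_i (\sum_j c1 j * A j i + \sum_s c2 s * R s i) * fox (x j) (e i) = 0.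
    by rewrite big1 // => i _; rewrite rel mul0r.
  under eq_bigr do rewrite mulrDl !mulr_suml.
  rewrite big_split /= exchange_big [X in _ + X]exchange_big /=.
  rewrite [X in _ + X]big1 ?addr0; last first.
    by move=> s _; under eq_bigr do rewrite -mulrA; rewrite -mulr_sumr R0 mulr0.
  rewrite (bigD1 j) //= [X in _ + X]big1 ?addr0.
    under eq_bigr do rewrite -mulrA.
    by rewrite -mulr_sumr -hA (fox_basis fX _ (Xx j)) eqxx mulr1.
  move=> j' jj'; under eq_bigr do rewrite -mulrA.
  by rewrite -mulr_sumr -hA (fox_basis fX _ (Xx j')) (inj_eq ix) (negbTE jj') mulr0.
(* What remains of the dependency, read on the columns of [a], annihilates the gradients of [l]. *)
have c20 : forall s, c2 s = 0.
  apply: li => y Xy; under eq_bigr do rewrite hP mulr_sumr.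
  rewrite exchange_big /= big1 // => i _.
  have := rel (lshift q i); rewrite big1 ?add0r; last by move=> j _; rewrite c10 mul0r.
  have Rl s : R s (lshift q i) = P s i by rewrite /R (unsplitK (inl i)).
  move=> r0; under eq_bigr do rewrite mulrA -Rl.
  by rewrite -mulr_suml r0 mul0r.
by apply: nz; case: (splitP k0) => j ej; [rewrite -(c10 j)|rewrite -(c20 j)]; congr c; apply: val_inj.
Qed.

(** * Gradients of a separated basis of the intersection *)

Variable n : nat.
Variable x : 'I_n -> F.
Hypothesis ix : injective x.
Hypothesis rx : range x = X.
Variable B : set F.
Hypothesis fB : free_basis (H `&` K) B.
Hypothesis sB : separated (o := o) X (H `&` K) B.

Let L := H `&` K.
Let sL : subgroup L := free_basis_subgroup fB.
Let BL : B `<=` L := free_basis_sub fB.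
Let LJ : L `<=` J. Proof. by move=> g [/HJ]. Qed.

Lemma boundary_relation m (c : 'I_m -> D) (l : 'I_m -> F) : (forall i, B (l i)) ->
  (forall y, X y -> \sum_i c i * fox y (l i) = 0) -> \sum_i c i * (grp (l i) - 1) = 0.
Proof.
move=> Bl h.
under eq_bigr => i _ do rewrite -(fox_boundary fX rx ix (LJ (BL (Bl i)))) mulr_sumr.
rewrite exchange_big /= big1 // => j _; under eq_bigr do rewrite mulrA.
by rewrite -mulr_suml h ?mul0r // -rx; exists j.
Qed.

Lemma basis_sub1_neq0 g : B g -> grp (o := o) g - 1 <> 0.
Proof.
move=> Bg /eqP; rewrite subr_eq0 => /eqP/grp_inj g1.
have [y [t [Xy /(_ g Bg)]]] := sB Bg; rewrite eqxx g1 (fox1 fX) mul0r (restr_id (supported0 L)).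
by move/esym/eqP; rewrite oner_eq0.
Qed.

(* The boundary map turns a D-linear relation between two gradients into one
   over D_L, where [separated_independent] applies. *)
Lemma gradients_independent2 (l : 'I_2 -> F) (c : 'I_2 -> D) : injective l -> (forall i, B (l i)) ->
  (forall y, X y -> \sum_i c i * fox y (l i) = 0) -> forall i, c i = 0.
Proof.
move=> il Bl h; set i0 : 'I_2 := ord0; set i1 : 'I_2 := ord_max.
have := boundary_relation Bl h; rewrite big_ord_recl big_ord1 -/i0.
have -> : lift ord0 ord0 = i1 by apply: val_inj.
move=> rel; have [g [g1 g2]] := series_inv (basis_sub1_neq0 (Bl i1)).
(* The boundary relation forces [c i1] to be [- (c i0 * w)], and [w] lies in D_L. *)
pose w := (grp (l i0) - 1) * g.
have sg : supported L g.
  apply: supported_inv g1 => //; apply: supportedD; first by apply: supported_sing; apply: BL.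
  by apply: supportedN; apply: supported1.
have sw : supported L w.
  apply: supportedM => //; apply: supportedD; first by apply: supported_sing; apply: BL.
  by apply: supportedN; apply: supported1.
have c1 : c i1 = - (c i0 * w).
  move: rel => /eqP; rewrite addrC addr_eq0 => /eqP rel.
  by rewrite -[c i1]mulr1 -g1 mulrA rel mulNr /w mulrA.
have c0 : c i0 = 0.
  apply: contrapT => nz.
  (* The given relation divided on the left by [c i0]. *)
  pose d (i : 'I_2) : D := if i == i0 then 1 else - w.
  have : d i0 = 0; last by rewrite /d eqxx => /eqP; rewrite oner_eq0.
  apply: (separated_independent sL sB il Bl) => [i|y Xy].
    rewrite /d; case: ifP => _; first exact: supported1.
    exact: supportedN.
  have := h y Xy; rewrite !big_ord_recl !big_ord0 !addr0 -/i0.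
  have -> : lift ord0 ord0 = i1 by apply: val_inj.
  rewrite c1 /d /= mul1r !mulNr => e0.
  by apply: (series_mulf_eq0 _ nz); rewrite mulrBr mulrA.
move=> i; have [j ->|->] := unliftP ord0 i; last exact: c0.
have -> : lift ord0 j = i1 by rewrite (ord1 j); apply: val_inj.
by rewrite c1 c0 mul0r oppr0.
Qed.

Lemma gradients_independent m (l : 'I_m -> F) : (m <= 2)%N -> injective l -> (forall i, B (l i)) ->
  forall c : 'I_m -> D, (forall y, X y -> \sum_i c i * fox y (l i) = 0) -> forall i, c i = 0.
Proof.
case: m l => [|[|[|//]]] l _ il Bl c h; first by case.
  move=> i; rewrite (ord1 i); have := boundary_relation Bl h; rewrite big_ord1.
  have [g [g1 _]] := series_inv (basis_sub1_neq0 (Bl ord0)).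
  by move/(congr1 (fun d => d * g)); rewrite /= -mulrA g1 mulr1 mul0r.
exact: (gradients_independent2 il Bl h).
Qed.

(** Three rows over at most two generators are dependent already over D_G. The last coefficient is
    nonzero, since the first two gradients are independent over D, and its inverse stays in D_G. *)
Lemma dependent_over k (u : 'I_k -> F) (l : 'I_3 -> F) (G := generated (range u)) :
  (k <= 2)%N -> G `<=` J -> L `<=` G -> injective l -> (forall i, B (l i)) ->
  exists c : 'I_2 -> D, (forall i, supported G (c i)) /\
    forall y, fox y (l ord_max) = \sum_i c i * fox y (l (widen_ord (leqnSn 2) i)).
Proof.
move=> k2 GJ LG il Bl; have sG : subgroup G := generated_subgroup _.
have uJ i : J (u i) by apply: GJ; apply: sub_generated; exists i.
have /choice[P hP] s := @fox_generated F o J X fX _ u (l s) uJ (LG _ (BL (Bl s))).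
have [|c [[s0 cs0] sc hc]] := dependent_rows (A := P) sG (leq_ltn_trans k2 (ltnSn 2)).
  by move=> s; case: (hP s).
have rel y : \sum_s c s * fox y (l s) = 0.
  under eq_bigr do rewrite (hP _).2 mulr_sumr; rewrite exchange_big big1 //= => i _.
  by under eq_bigr do rewrite mulrA; rewrite -mulr_suml hc mul0r.
have c2 : c ord_max <> 0.
  move=> c2; have c0 : forall i, c (widen_ord (leqnSn 2) i) = 0.
    apply: (@gradients_independent2 (fun i => l (widen_ord (leqnSn 2) i))) => // [i j /il /(congr1 val) /=|y _].
      exact: val_inj.
    by have := rel y; rewrite big_ord_recr /= c2 mul0r addr0.
  apply: cs0; have [es|ne] := eqVneq s0 ord_max; first by rewrite es.
  have s2 : (s0 < 2)%N.
    by move: (ltn_ord s0); rewrite ltnS leq_eqVlt => /orP[/eqP es|//]; case/eqP: ne; apply: val_inj.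
  by rewrite -(c0 (Ordinal s2)); congr c; apply: val_inj.
have [v [v1 v2]] := series_inv c2.
have sv : supported G v by apply: supported_inv v1.
exists (fun i => - (v * c (widen_ord (leqnSn 2) i))); split=> [i|y].
  by apply: supportedN; apply: supportedM.
have := rel y; rewrite big_ord_recr /= addrC => /eqP; rewrite addr_eq0 => /eqP e2.
rewrite -[LHS]mul1r -v2 -mulrA e2 mulrN mulr_sumr -sumrN.
by apply: eq_bigr => i _; rewrite mulNr mulrA.
Qed.

(* The coefficients of the third gradient lie in both D_H and D_K, hence in D_L. *)
Lemma basis_no_triple (l : 'I_3 -> F) : (p <= 2)%N -> (q <= 2)%N ->
  injective l -> (forall i, B (l i)) -> False.
Proof.
move=> p2 q2 il Bl.
have [c [sc hc]] := dependent_over p2 HJ (@subIsetl _ _ _) il Bl.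
have [d [sd hd]] := dependent_over q2 KJ (@subIsetr _ _ _) il Bl.
pose iw (i : 'I_2) : 'I_3 := widen_ord (leqnSn 2) i.
(* Both families expand the third gradient over the first two, which are independent over D. *)
have cd i : c i = d i.
  apply/eqP; rewrite -subr_eq0; apply/eqP; move: i.
  apply: (@gradients_independent2 (fun i => l (iw i))) => // [i j /il /(congr1 val) /=|y _].
    exact: val_inj.
  by under eq_bigr do rewrite mulrBl; rewrite sumrB -hc -hd subrr.
have scL i : supported L (c i) by apply: supportedI; [apply: sc|rewrite cd; apply: sd].
(* The index 2, where [insub] fails, belongs to the third gradient and gets -1. *)
pose w (i : 'I_3) : D := if insub (val i) is Some j then c j else - 1.
have wi i : w (iw i) = c i by rewrite /w /= valK.
have wm : w ord_max = - 1 by rewrite /w insubF.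
have : w ord_max = 0.
  apply: (separated_independent sL sB il Bl) => [i|y Xy].
    by rewrite /w; case: insub => [j|] //; apply: supportedN; apply: supported1.
  rewrite big_ord_recr /= wm mulN1r hc; under eq_bigr do rewrite wi.
  by rewrite subrr.
by rewrite wm => /eqP; rewrite oppr_eq0 oner_eq0.
Qed.

End Intersection.

Theorem theorem3 (F : groupType) (hF : free_group F) (H K : set F)
    (hH : subgroup H) (hK : subgroup K)
    (rH : has_rank H 2) (rK : has_rank K 2) :
  exists m n : nat,
    [/\ has_rank (H `&` K) m,
        has_rank (join H K) n
      & (m%:Z <= 4%:Z - n%:Z)%R].
Proof.
have [BF fF] := hF; pose o := free_biorder fF.
have [BH [[gH _] /card_enum[a [_ ra]]]] := rH.
have [BK [[gK _] /card_enum[b [_ rb]]]] := rK.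
have eH : generated (range a) = H by rewrite ra.
have eK : generated (range b) = K by rewrite rb.
have sJ : subgroup (join H K) := generated_subgroup _.
have HJ : generated (range a) `<=` join H K.
  by rewrite eH => x Hx; apply: sub_generated; left.
have KJ : generated (range b) `<=` join H K.
  by rewrite eK => x Kx; apply: sub_generated; right.
have eJ : join H K = generated (generated (range a) `|` generated (range b)) by rewrite eH eK.
have [X [fX _]] := schreier_basis o fF sJ (@subsetT _ _).
have [|B [fB sB]] := schreier_basis o fX (subgroupI hH hK) _.
  by move=> x [Hx _]; apply: sub_generated; left.
(* With an empty common family, five elements of [X] would give 5 <= 4. Finiteness of [X] is needed
   before the boundary formula can be used. *)
have [n n4 Xn] : exists2 n, (n <= 4)%N & (X #= `I_n)%card.
  apply: card_bounded => x ix Xx.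
  suff : (5 + 0 <= 2 + 2)%N by [].
  by apply: (@rank_bound F o _ X fX 2 2 a b HJ KJ eJ 5 0 x (fun=> 1%g)) => // [[]|[]|c _ []].
have [x [ix rx]] := card_enum Xn.
rewrite -eH -eK in fB sB.
have [m m2 Bm] : exists2 m, (m <= 2)%N & (B #= `I_m)%card.
  apply: card_bounded => l il Bl.
  exact: (basis_no_triple fX HJ KJ ix rx fB sB _ _ il Bl).
have [l [il rl]] := card_enum Bm.
have Bl i : B (l i) by rewrite -rl; exists i.
have Ll i := free_basis_sub fB (Bl i).
exists m, n; split; [by rewrite -eH -eK; exists B|by exists X|].
have mn : (n + m <= 2 + 2)%N.
  apply: (rank_bound (o := o) (l := l) fX HJ KJ eJ ix) => [i|i|i|].
  - by rewrite -rx; exists i.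
  - by case: (Ll i) => Hl _; exact: Hl.
  - by case: (Ll i) => _ Kl; exact: Kl.
  - exact: (gradients_independent fX HJ ix rx fB sB m2 il Bl).
by rewrite lerBrDr -PoszD lez_nat addnC.
Qed.
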